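(* Let $(G,u)$ be a unital po-group (not necessarily Abelian) satisfying (RDP), and let $s$ be a state on the pseudo effect algebra $E=\Gamma(G,u)$. Then there is a unique maximal regular Borel probability measure $\mu_s\sim\delta_s$ on $\mathcal B(\mathcal S(E))$ such that $$s(a)=\int_{\mathcal S(E)}\hat a(x)\,\mathrm d\mu_s(x),\qquad a\in E.$$
   Context: Groups are written additively and are not assumed Abelian. A po-group is a group $G$ with a partial order $\le$ such that $a\le b$ implies $x+a+y\le x+b+y$ for all $x,y\in G$; $G^+=\{g\in G: g\ge 0\}$. A strong unit of $G$ is an element $u\in G^+$ such that for every $g\in G$ there is an integer $n\ge1$ with $g\le nu$; a unital po-group $(G,u)$ is a po-group with a fixed strong unit $u$ (it is then directed). (RDP) for a directed po-group $G$: for all $a_1,a_2,b_1,b_2\in G^+$ with $a_1+a_2=b_1+b_2$ there are $d_1,d_2,d_3,d_4\in G^+$ with $d_1+d_2=a_1$, $d_3+d_4=a_2$, $d_1+d_3=b_1$, $d_2+d_4=b_2$. $\Gamma(G,u)=\{g\in G:0\le g\le u\}$ with the partial addition that is the restriction of the group addition ($a+b$ is defined iff the group sum lies in $\Gamma(G,u)$) and constants $0,u$; this is a pseudo effect algebra with top element $1=u$. A state on $E=\Gamma(G,u)$ is a map $s:E\to[0,1]$ with $s(a+b)=s(a)+s(b)$ whenever $a+b$ is defined in $E$ and $s(u)=1$. $\mathcal S(E)$ is the set of all states, a compact convex Hausdorff space under pointwise (weak) convergence. For $a\in E$, $\hat a:\mathcal S(E)\to[0,1]$ is $\hat a(x)=x(a)$.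 For a compact convex subset $K$ of a locally convex Hausdorff space: $\mathcal B(K)$ is the Borel $\sigma$-algebra; a Borel measure $\mu$ is regular if $\inf\{\mu(O): Y\subseteq O,\ O\text{ open}\}=\mu(Y)=\sup\{\mu(C): C\subseteq Y,\ C\text{ closed}\}$ for all $Y\in\mathcal B(K)$; $\delta_x$ is the Dirac measure at $x$; $\mathrm{Aff}(K)$ is the set of continuous affine functions $K\to\mathbb R$. $\mu\sim\lambda$ means $\int_K f\,\mathrm d\mu=\int_K f\,\mathrm d\lambda$ for all $f\in\mathrm{Aff}(K)$. The Choquet ordering is $\mu\prec\lambda$ iff $\int_K f\,\mathrm d\mu\le\int_K f\,\mathrm d\lambda$ for all continuous convex $f:K\to\mathbb R$. A regular Borel probability measure is maximal if it is maximal for $\prec$ among regular Borel probability measures on $K$. *)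

(* Defs.v *)
From HB Require Import structures.
From mathcomp Require Import all_boot all_order all_algebra.
From mathcomp Require Import all_classical all_reals all_analysis.

Set Implicit Arguments.
Unset Strict Implicit.
Unset Printing Implicit Defensive.

Import Order.TTheory GRing.Theory Num.Theory.
Import numFieldNormedType.Exports.

Local Open Scope classical_set_scope.
Local Open Scope ring_scope.
Local Open Scope convex_scope.

(* The additive groups of MathComp are Abelian, so po-groups are based on the
   multiplicative [groupType]: [x * y], [1] and [x ^+ n] stand for the
   mathematical x + y, 0 and n x. *)
HB.mixin Record isPOGroup (d : Order.disp_t) G
    & Group G & Order.POrder d G := {
  pogroup_le : forall a b x y : G,
    (a <= b)%O -> (x * a * y <= x * b * y :> G)%O%g
}.

#[short(type="pogroupType")]
HB.structure Definition POGroup (d : Order.disp_t) :=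
  {G of Group G & Order.POrder d G & isPOGroup d G}.

HB.mixin Record hasStrongUnit (d : Order.disp_t) G & POGroup d G := {
  strong_unit : G;
  strong_unit_ge0 : (1%g <= strong_unit)%O;
  strong_unitP : forall g : G,
    exists2 n : nat, (0 < n)%N & (g <= (strong_unit ^+ n)%g)%O
}.

#[short(type="unitalPogroupType")]
HB.structure Definition UnitalPOGroup (d : Order.disp_t) :=
  {G of POGroup d G & hasStrongUnit d G}.

Definition RDP (d : Order.disp_t) (G : pogroupType d) : Prop :=
  forall a1 a2 b1 b2 : G,
    (1%g <= a1)%O -> (1%g <= a2)%O -> (1%g <= b1)%O -> (1%g <= b2)%O ->
    (a1 * a2 = b1 * b2)%g ->
  exists d1 d2 d3 d4 : G,
    [/\ (1%g <= d1)%O, (1%g <= d2)%O, (1%g <= d3)%O & (1%g <= d4)%O] /\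
    [/\ d1 * d2 = a1, d3 * d4 = a2, d1 * d3 = b1 & d2 * d4 = b2]%g.

Section Gamma.
Context (d : Order.disp_t) (G : unitalPogroupType d).

Definition Gamma := {g : G | (1%g <= g <= strong_unit)%O}.

Lemma Gamma_top_subproof : (1%g <= (strong_unit : G) <= strong_unit)%O.
Proof. by rewrite strong_unit_ge0 lexx. Qed.

Definition Gamma_top : Gamma := exist _ strong_unit Gamma_top_subproof.

(* [None] when the group sum lies outside [Gamma] *)
Definition Gamma_add (a b : Gamma) : option Gamma := insub (val a * val b)%g.

End Gamma.

HB.instance Definition _ (U : Type) (R : realType) :=
  GRing.Lmodule.copy {ptws U -> R^o} (U -> R^o).

Section states.
Context (R : realType) (d : Order.disp_t) (G : unitalPogroupType d).

Definition is_state (x : Gamma G -> R) : Prop :=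
  [/\ forall a, 0 <= x a <= 1,
      forall a b c, Gamma_add a b = Some c -> x c = x a + x b
    & x (Gamma_top G) = 1].

Definition states : set {ptws Gamma G -> R^o} := [set x | is_state x].

Definition hat (a : Gamma G) (x : states) : R := \val x a.

End states.

Arguments states R {d} G.

(* [K : set V] as a space of its own. The measurable types of the library are
   pointed, whence the argument [x0]; nothing else depends on it. *)
Section borel.
Context (V : topologicalType) (K : set V).

Definition pset_type (x0 : K) : Type := K.

HB.instance Definition _ (x0 : K) := Topological.copy (pset_type x0) K.
HB.instance Definition _ (x0 : K) := isPointed.Build (pset_type x0) x0.

Definition borel_type (x0 : K) :=
  g_sigma_algebraType (@open (pset_type x0)).

End borel.

Section Choquet.
Context (R : realType) (V : preTopologicalLmodType R) (K : set V) (x0 : K).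
Local Notation T := (borel_type x0).
Implicit Types mu nu : {measure set T -> \bar R}.

(* Measures of the library are functions on all sets, with junk values outside
   the sigma-algebra, so they are not compared with [=]. *)
Definition borel_eq mu nu : Prop :=
  forall Y : set T, measurable Y -> mu Y = nu Y.

Definition regular mu : Prop := forall Y : set T, measurable Y ->
  ereal_inf [set mu O | O in [set O : set (pset_type x0) | open O /\ Y `<=` O]]
    = mu Y /\
  mu Y =
  ereal_sup [set mu C | C in [set C : set (pset_type x0) | closed C /\ C `<=` Y]].

(* Real functions on [K] are given by functions on [V], of which only the
   values on [K] matter, as for the library's [convex_function]. *)
Definition affine_function (f : V -> R^o) : Prop :=
  forall t : {i01 R}, {in K &, forall x y : convex_lmodType V,
    f (x <| t |> y) = f x <| t |> f y}.

Definition Aff : set (V -> R^o) :=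
  [set f | {within K, continuous f} /\ affine_function f].

Definition Aff_equiv mu nu : Prop := forall f, Aff f ->
  (\int[mu]_x (f (\val x))%:E = \int[nu]_x (f (\val x))%:E)%E.

Definition choquet_le mu nu : Prop := forall f : V -> R^o,
  {within K, continuous f} -> convex_function K f ->
  (\int[mu]_x (f (\val x))%:E <= \int[nu]_x (f (\val x))%:E)%E.

Definition maximal (mu : probability T R) : Prop :=
  regular mu /\ forall nu : probability T R,
    regular nu -> choquet_le mu nu -> borel_eq mu nu.

End Choquet.

(* Main.v *)
Require Import Defs.
From HB Require Import structures.
From mathcomp Require Import all_boot all_order all_algebra.
From mathcomp Require Import all_classical all_reals all_analysis.
From mathcomp Require Import measurable_realfun lra ring.

(** Write E for [Gamma G], u for its top element, K for the state space, and C
    for the cone of nonnegative additive maps on E, whose elements are the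
    nonnegative multiples of states. The reason for uniqueness is that
    K is a Choquet simplex; the argument works directly with decompositions
    of s.

    A decomposition of s is a finite family in C with sum s. It is the same
    thing as a finitely supported probability on K with barycentre s: the
    member z puts mass z(u) at the state z / z(u). Replacing the members by
    finer decompositions of them increases the average of every convex function,
    because z |-> z(u) f(z / z(u)) is subadditive on C when f is convex. The
    decisive consequence of (RDP) is that C itself has the Riesz refinement
    property ([cone_refinement]), so that any two decompositions of s have a
    common refinement ([common_refinement]).

    Decompositions are therefore directed by refinement, and along an
    ultrafilter containing all the sets of refinements the averages of every
    bounded function converge. The limit is a positive normalized functional on
    all bounded functions; restricting it to indicators and regularizing gives a
    regular Borel probability mu that dominates, on continuous convex functions,
    every decomposition of s ([exists_dominating_measure]).

    Conversely, a Borel probability nu with barycentre s is a limit of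
    decompositions: cut K into small Borel pieces A and take the members
    a |-> int_A a^ dnu ([decomposition_approx]). Hence nu precedes mu in the
    Choquet ordering for every nu ~ delta_s: mu is the greatest element among
    these measures. As everything above mu is again ~ delta_s, and regular
    measures with equal integrals of convex functions coincide ([regular_eq],
    through Urysohn functions that are differences of convex functions), mu is
    maximal; and a maximal nu ~ delta_s, lying below mu, is equal to mu. *)

Set Implicit Arguments.
Unset Strict Implicit.
Unset Printing Implicit Defensive.

Import Order.TTheory GRing.Theory Num.Theory.
Import numFieldNormedType.Exports.

Local Open Scope classical_set_scope.
Local Open Scope ring_scope.
Local Open Scope convex_scope.

(** * Refinement in the cone of positive additive maps *)

Section pogroup_lemmas.
Context (d : Order.disp_t) (G : pogroupType d).
Local Open Scope group_scope.
Implicit Types x y z : G.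

Lemma pog_mull x y z : (x <= y)%O -> (z * x <= z * y :> G)%O.
Proof. by move=> /(@pogroup_le _ G _ _ z 1); rewrite !mulg1. Qed.

Lemma pog_mulr x y z : (x <= y)%O -> (x * z <= y * z :> G)%O.
Proof. by move=> /(@pogroup_le _ G _ _ 1 z); rewrite !mul1g. Qed.

Lemma pog_ge1_mulr x y : (1 <= x :> G)%O -> (y <= y * x :> G)%O.
Proof. by move=> /(pog_mull y); rewrite mulg1. Qed.

Lemma pog_ge1_mull x y : (1 <= x :> G)%O -> (y <= x * y :> G)%O.
Proof. by move=> /(pog_mulr y); rewrite mul1g. Qed.

Lemma pog_ge1M x y : (1 <= x :> G)%O -> (1 <= y :> G)%O -> (1 <= x * y :> G)%O.
Proof. by move=> x1 y1; exact: le_trans x1 (pog_ge1_mulr _ _). Qed.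

End pogroup_lemmas.

Section cone.
Context (R : realType) (d : Order.disp_t) (G : unitalPogroupType d).
Local Notation E := (Gamma G).
Local Notation u := (Gamma_top G).
Implicit Types (a b c : E) (y z w : E -> R) (ys zs ws rs : seq (E -> R)).

Let addE y z a : (y + z) a = y a + z a. Proof. by []. Qed.
Let subE y z a : (y - z) a = y a - z a. Proof. by []. Qed.

Lemma Gamma_addP a b c :
  Gamma_add a b = Some c <-> (val a * val b)%g = val c.
Proof.
rewrite /Gamma_add; case: insubP => [x _ <-|nab]; split.
- by case=> ->.
- by move/val_inj => ->.
- by [].
- move=> e; case/negP: nab; have := valP c; rewrite /=.
  by rewrite -[X in (1%g <= X <= _)%O -> _]e.
Qed.

Lemma Gamma_ge1 a : (1%g <= val a)%O. Proof. by case/andP: (valP a). Qed.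

Lemma Gamma_le a : (val a <= strong_unit)%O. Proof. by case/andP: (valP a). Qed.

Lemma Gamma_sub (g : G) a : (1%g <= g)%O -> (g <= val a)%O ->
  {b : E | val b = g}.
Proof.
move=> g1 ga.
have gu : (1%g <= g <= strong_unit)%O by rewrite g1 (le_trans ga (Gamma_le a)).
by exists (exist _ g gu).
Qed.

Lemma Gamma_one : {b : E | val b = 1%g}.
Proof. exact: (Gamma_sub (a := u) (lexx _) (Gamma_ge1 _)). Qed.

Definition posadd z : Prop :=
  (forall a, 0 <= z a) /\
  forall a b c, (val a * val b)%g = val c -> z c = z a + z b.

Lemma state_posadd z : is_state z -> posadd z.
Proof.
move=> [z01 zD _]; split=> [a|a b c /Gamma_addP]; last exact: zD.
by case/andP: (z01 a).
Qed.

Lemma posaddD y z : posadd y -> posadd z -> posadd (y + z).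
Proof.
move=> [y0 yD] [z0 zD]; split=> [a|a b c abc]; first exact: addr_ge0.
by rewrite !addE (yD _ _ _ abc) (zD _ _ _ abc); ring.
Qed.

Lemma posadd0 : posadd 0.
Proof. by split=> // a b c _; rewrite addr0. Qed.

Lemma posaddB y z : posadd y -> posadd z -> (forall a, z a <= y a) ->
  posadd (y - z).
Proof.
move=> [y0 yD] [z0 zD] zy; split=> [a|a b c abc].
  by rewrite subE subr_ge0.
rewrite !subE (yD _ _ _ abc) (zD _ _ _ abc).
by ring.
Qed.

Lemma posadd_sum zs : {in zs, forall z, posadd z} -> posadd (\sum_(z <- zs) z).
Proof.
elim: zs => [_|z zs ih h]; first by rewrite big_nil; exact: posadd0.
rewrite big_cons; apply: posaddD; first by apply: h; rewrite mem_head.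
by apply: ih => w wzs; apply: h; rewrite in_cons wzs orbT.
Qed.

Lemma posadd_le z a b : posadd z -> (val a <= val b)%O -> z a <= z b.
Proof.
move=> [z0 zD] ab.
have g1 : (1%g <= (val a)^-1 * val b)%O%g.
  by have := pog_mull (val a)^-1%g ab; rewrite mulVg.
have gb : ((val a)^-1 * val b <= val b)%O%g.
  have := pog_ge1_mull ((val a)^-1 * val b)%g (Gamma_ge1 a).
  by rewrite mulVKg.
have [c cE] := Gamma_sub g1 gb.
by rewrite (zD a c b) ?lerDl// cE mulVKg.
Qed.

Lemma posadd_le_top z a : posadd z -> z a <= z u.
Proof. by move=> pz; apply: posadd_le => //; exact: Gamma_le. Qed.

Lemma posadd_top0 z : posadd z -> z u = 0 -> z = 0.
Proof.
move=> pz zu; apply/funext => a; apply/eqP; rewrite eq_le (pz.1 a) andbT.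
by rewrite -[X in _ <= X]zu posadd_le_top.
Qed.

(** An additive map cannot see non-commutativity: conjugating an element of E
    within E does not change its value. *)
Lemma posadd_conj z a b b' : posadd z ->
  (val a * val b)%g = (val b' * val a)%g ->
  (val a * val b <= strong_unit)%O%g -> z b' = z b.
Proof.
move=> [_ zD] ab abu.
have abu' : (val a * val b <= val u)%O%g by [].
have [c cE] := Gamma_sub (pog_ge1M (Gamma_ge1 a) (Gamma_ge1 b)) abu'.
have := zD a b c (esym cE); rewrite (zD b' a c) ?cE// addrC.
by move/addrI.
Qed.

(** The infimum of [z] and [w] in the cone, by the formula of Riesz and
    Kantorovich. *)
Definition cone_meet z w : E -> R := fun a =>
  inf [set t | exists b c, (val b * val c)%g = val a /\ t = z b + w c].

Section meet.
Variables (z w : E -> R) (hz : posadd z) (hw : posadd w).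

Let S a := [set t | exists b c, (val b * val c)%g = val a /\ t = z b + w c].

Let S_inf a : has_inf (S a).
Proof.
have [e eE] := Gamma_one.
split; first by exists (z a + w e), a, e; rewrite eE mulg1.
by exists 0 => _ [b [c [_ ->]]]; rewrite addr_ge0 ?hz.1 ?hw.1.
Qed.

Lemma cone_meet_le a b c : (val b * val c)%g = val a ->
  cone_meet z w a <= z b + w c.
Proof. by move=> h; apply: (inf_lbound (S_inf a).2); exists b, c. Qed.

Lemma cone_meet_ge a (t : R) :
  (forall b c, (val b * val c)%g = val a -> t <= z b + w c) ->
  t <= cone_meet z w a.
Proof.
move=> h; apply: lb_le_inf; first exact: (S_inf a).1.
by move=> _ [b [c [bc ->]]]; exact: h.
Qed.

Lemma cone_meet_lel a : cone_meet z w a <= z a.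
Proof.
have [e eE] := Gamma_one.
have w0 : w e = 0.
  by have := hw.2 e e e; rewrite eE mulg1 => /(_ erefl); lra.
by have := @cone_meet_le a a e; rewrite eE mulg1 w0 addr0; exact.
Qed.

Lemma cone_meet_ler a : cone_meet z w a <= w a.
Proof.
have [e eE] := Gamma_one.
have z0 : z e = 0.
  by have := hz.2 e e e; rewrite eE mulg1 => /(_ erefl); lra.
by have := @cone_meet_le a e a; rewrite eE mul1g z0 add0r; exact.
Qed.

(** Superadditivity is where (RDP) enters: a splitting b + c of a1 + a2 is
    refined into splittings of a1 and of a2. For subadditivity, splittings
    b1 + c1 of a1 and b2 + c2 of a2 have to be combined into one of a1 + a2;
    since c1 + b2 is not b2 + c1, the element b2 is replaced by its conjugate
    by c1, which [posadd_conj] allows. *)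
Lemma posadd_cone_meet : RDP G -> posadd (cone_meet z w).
Proof.
move=> rdp; split=> [a|a1 a2 a a12].
  by apply: cone_meet_ge => b c _; rewrite addr_ge0 ?hz.1 ?hw.1.
apply/eqP; rewrite eq_le; apply/andP; split; last first.
  apply: cone_meet_ge => b c bc.
  have [d1 [d2 [d3 [d4 [[p1 p2 p3 p4] [e1 e2 e3 e4]]]]]] :=
    rdp _ _ _ _ (Gamma_ge1 a1) (Gamma_ge1 a2) (Gamma_ge1 b) (Gamma_ge1 c)
        (etrans a12 (esym bc)).
  have [c1 E1] : {x : E | val x = d1}.
    by apply: (Gamma_sub (a := a1)) => //; rewrite -e1 pog_ge1_mulr.
  have [c2 E2] : {x : E | val x = d2}.
    by apply: (Gamma_sub (a := a1)) => //; rewrite -e1 pog_ge1_mull.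
  have [c3 E3] : {x : E | val x = d3}.
    by apply: (Gamma_sub (a := a2)) => //; rewrite -e2 pog_ge1_mulr.
  have [c4 E4] : {x : E | val x = d4}.
    by apply: (Gamma_sub (a := a2)) => //; rewrite -e2 pog_ge1_mull.
  subst.
  rewrite (hz.2 _ _ _ e3) (hw.2 _ _ _ e4).
  by have := cone_meet_le e1; have := cone_meet_le e2; lra.
rewrite -lerBlDr; apply: cone_meet_ge => b1 c1 bc1.
rewrite lerBlDr addrC -lerBlDr; apply: cone_meet_ge => b2 c2 bc2.
rewrite lerBlDr.
(* c1 + b2 = b2' + c1, and all of it stays below a *)
have au : (val c1 * val b2 <= val a)%O%g.
  rewrite -a12 -bc1 -bc2 -!mulgA.
  apply: le_trans (pog_ge1_mull _ (Gamma_ge1 b1)).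
  by apply: pog_mull; apply: pog_ge1_mulr; exact: Gamma_ge1.
have [b2' E2] : {x : E | val x = (val c1 * val b2 * (val c1)^-1)%g}.
  apply: (Gamma_sub (a := a)).
    have := pog_mulr (val c1)^-1%g (pog_ge1_mulr (val c1) (Gamma_ge1 b2)).
    by rewrite mulgV.
  apply: le_trans au.
  have := pog_ge1_mulr (val c1 * val b2 * (val c1)^-1)%g (Gamma_ge1 c1).
  by rewrite mulgVK.
have zb : z b2' = z b2.
  apply: (posadd_conj (a := c1)) => //; first by rewrite E2 mulgVK.
  exact: le_trans au (Gamma_le a).
have bE : (val b1 * val b2' * (val c1 * val c2))%g = val a.
  by rewrite E2 -a12 -bc1 -bc2 -!mulgA mulKg.
have b1' := pog_ge1M (Gamma_ge1 b1) (Gamma_ge1 b2').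
have c1' := pog_ge1M (Gamma_ge1 c1) (Gamma_ge1 c2).
have [b Eb] : {x : E | val x = (val b1 * val b2')%g}.
  by apply: (Gamma_sub (a := a)) => //; rewrite -bE; exact: pog_ge1_mulr.
have [c Ec] : {x : E | val x = (val c1 * val c2)%g}.
  by apply: (Gamma_sub (a := a)) => //; rewrite -bE; exact: pog_ge1_mull.
have := @cone_meet_le a b c; rewrite Eb Ec => /(_ bE).
by rewrite (hz.2 _ _ _ (esym Eb)) (hw.2 _ _ _ (esym Ec)) zb; lra.
Qed.

End meet.

(** The first cell of the refinement is the infimum of z1 and w1, and it
    determines the others. The last one, x - z1 - w1 + inf(z1, w1) with x the
    common sum, is nonnegative because z1 and w1 are both below x. *)
Lemma cone_refinement z1 z2 w1 w2 : RDP G ->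
  posadd z1 -> posadd z2 -> posadd w1 -> posadd w2 -> z1 + z2 = w1 + w2 ->
  exists r11 r12 r21 r22,
    [/\ posadd r11, posadd r12, posadd r21 & posadd r22] /\
    [/\ z1 = r11 + r12, z2 = r21 + r22, w1 = r11 + r21 & w2 = r12 + r22].
Proof.
move=> rdp hz1 hz2 hw1 hw2 zw.
have hm := posadd_cone_meet hz1 hw1 rdp; set m := cone_meet z1 w1 in hm.
have zwE a : z1 a + z2 a = w1 a + w2 a by have := congr1 (@^~ a) zw.
exists m, (z1 - m), (w1 - m), (z2 - (w1 - m)); split; split.
- exact: hm.
- by apply: posaddB => // a; exact: cone_meet_lel.
- by apply: posaddB => // a; exact: cone_meet_ler.
- apply: posaddB => //; first by apply: posaddB => // a; exact: cone_meet_ler.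
  move=> a; rewrite ?subE ?addE lerBlDr -lerBlDl.
  apply: cone_meet_ge => // b c bca.
  rewrite (hz2.2 _ _ _ bca) (hw1.2 _ _ _ bca).
  by have := hw2.1 b; have := zwE b; have := hz2.1 c; lra.
- by rewrite addrC subrK.
- by rewrite addrC subrK.
- by rewrite addrC subrK.
- have -> : w2 = z1 + z2 - w1 by rewrite zw addrC addrA addNr add0r.
  by apply/funext => a; rewrite ?(subE,addE); ring.
Qed.

Definition cone_subadditive (F : (E -> R) -> R) : Prop :=
  F 0 = 0 /\ forall y z, posadd y -> posadd z -> F (y + z) <= F y + F z.

(** Refinement is only used through its effect on subadditive functions, and is
    defined by it: [ws] and [zs] need not be matched member by member. *)
Definition refines ws zs : Prop := forall F, cone_subadditive F ->
  \sum_(w <- ws) F w <= \sum_(z <- zs) F z.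

Lemma cone_subadditive_sum F zs : cone_subadditive F ->
  {in zs, forall z, posadd z} -> F (\sum_(z <- zs) z) <= \sum_(z <- zs) F z.
Proof.
move=> hF; elim: zs => [_|z zs ih h]; first by rewrite !big_nil hF.1.
have hzs : {in zs, forall w, posadd w}.
  by move=> w wzs; apply: h; rewrite in_cons wzs orbT.
rewrite !big_cons (le_trans (hF.2 _ _ _ _))//.
- by apply: h; rewrite mem_head.
- exact: posadd_sum.
- by rewrite lerD2l ih.
Qed.

(** Peels off one member at a time of one of two decompositions of the same
    element; the refinement of the other one it yields is what makes the
    induction of [common_refinement] work. *)
Lemma split_decomposition z y ws : RDP G -> posadd z -> posadd y ->
  {in ws, forall w, posadd w} -> \sum_(w <- ws) w = z + y ->
  exists ps qs, [/\ {in ps, forall w, posadd w}, {in qs, forall w, posadd w},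
    \sum_(w <- ps) w = z, \sum_(w <- qs) w = y & refines ws (ps ++ qs)].
Proof.
move=> rdp; elim: ws z y => [|w ws ih] z y hz hy h.
  rewrite big_nil => /esym zy0.
  have zy a : z a = 0 /\ y a = 0.
    have : 0 = z a + y a by have := congr1 (@^~ a) zy0.
    by have := hz.1 a; have := hy.1 a => ? ? ?; split; lra.
  exists [::], [::]; rewrite big_nil; split => //.
    by apply/funext => a; rewrite (zy a).1.
  by apply/funext => a; rewrite (zy a).2.
have hw : posadd w by apply: h; rewrite mem_head.
have hws : {in ws, forall w, posadd w}.
  by move=> v vws; apply: h; rewrite in_cons vws orbT.
rewrite big_cons => /esym e.
have [r11 [r12 [r21 [r22 [[h11 h12 h21 h22] [-> -> e3 e4]]]]]] :=
  cone_refinement rdp hz hy hw (posadd_sum hws) e.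
have [ps [qs [hp hq <- <- r]]] := ih _ _ h12 h22 hws e4.
exists (r11 :: ps), (r21 :: qs); rewrite !big_cons; split => //.
- by move=> v; rewrite in_cons => /orP[/eqP->|/hp].
- by move=> v; rewrite in_cons => /orP[/eqP->|/hq].
- move=> F hF; rewrite big_cons big_cat !big_cons.
  have := r F hF; rewrite big_cat/=; have := hF.2 _ _ h11 h21; rewrite -e3.
  lra.
Qed.

(** The members of [zs] are split off [ws] in turn; what each of them is split
    into refines it by subadditivity. *)
Lemma common_refinement zs ws : RDP G ->
  {in zs, forall w, posadd w} -> {in ws, forall w, posadd w} ->
  \sum_(w <- zs) w = \sum_(w <- ws) w ->
  exists rs, [/\ {in rs, forall w, posadd w},
    \sum_(w <- rs) w = \sum_(w <- zs) w, refines zs rs & refines ws rs].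
Proof.
move=> rdp; elim: zs ws => [|z zs ih] ws h hws.
  rewrite big_nil => e; exists ws; split => // F hF.
  by have := cone_subadditive_sum hF hws; rewrite -e hF.1 big_nil.
have hz : posadd z by apply: h; rewrite mem_head.
have hzs : {in zs, forall w, posadd w}.
  by move=> v vws; apply: h; rewrite in_cons vws orbT.
rewrite big_cons => /esym e.
have [ps [qs [hp hq ep eq r]]] :=
  split_decomposition rdp hz (posadd_sum hzs) hws e.
have [rs [hrs ers zrs qrs]] := ih _ hzs hq (esym eq).
exists (ps ++ rs); split.
- by move=> v; rewrite mem_cat => /orP[/hp|/hrs].
- by rewrite big_cat/= ep ers.
- move=> F hF; rewrite big_cons big_cat/= lerD ?zrs// -ep.
  exact: cone_subadditive_sum.
- move=> F hF; apply: le_trans (r _ hF) _.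
  by rewrite !big_cat/= lerD2l qrs.
Qed.

End cone.

(** * Regularization of a finitely additive probability on a compact space *)

(** [regular] for an arbitrary pointed space in place of a subset of a vector
    space; the two are convertible. *)
Definition borel_regular (R : realType) (T : ptopologicalType)
    (mu : set (g_sigma_algebraType (@open T)) -> \bar R) : Prop :=
  forall A : set (g_sigma_algebraType (@open T)), measurable A ->
    ereal_inf [set mu O | O in [set O : set T | open O /\ A `<=` O]] = mu A /\
    mu A = ereal_sup [set mu C | C in [set C : set T | closed C /\ C `<=` A]].

Section regularization.
Context (R : realType) (T : ptopologicalType).
Context (hT : hausdorff_space T) (cT : compact [set: T]).
Context (m : set T -> R) (m_ge0 : forall A, 0 <= m A).
Context (mU : forall A B, A `&` B = set0 -> m (A `|` B) = m A + m B).
Context (mT : m setT = 1).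
Implicit Types A B C O : set T.

Let m_le A B : A `<=` B -> m A <= m B.
Proof.
move=> AB; rewrite -(setDUK AB) mU ?lerDl//.
by rewrite setDE setICA setICr setI0.
Qed.

Let m0 : m set0 = 0.
Proof. by have := @mU set0 set0; rewrite setI0 setU0 => /(_ erefl); lra. Qed.

Let mU_le A B : m (A `|` B) <= m A + m B.
Proof.
rewrite -(setDUK (@subsetUl _ A B)) mU; last first.
  by rewrite setDE setICA setICr setI0.
by rewrite lerD2l; apply: m_le => x [[]].
Qed.

Let closedD C O : closed C -> open O -> closed (C `\` O).
Proof.
by move=> cC oO; rewrite setDE; apply: closedI => //; exact: open_closedC.
Qed.

(** The outer measure is built in two steps: open sets are measured from inside
    by the values of [m] on closed sets, and all sets from outside by open ones.
    On closed sets this can only increase [m], and on open sets only decrease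
    it. *)
Definition inner_open O : R :=
  sup [set m C | C in [set C | closed C /\ C `<=` O]].

Let inner_sup O : has_sup [set m C | C in [set C | closed C /\ C `<=` O]].
Proof.
split; first by exists (m set0), set0 => //; split => //; exact: closed0.
by exists 1 => _ [C _ <-]; rewrite -mT m_le.
Qed.

Lemma inner_open_ge C O : closed C -> C `<=` O -> m C <= inner_open O.
Proof. by move=> cC CO; apply: (ub_le_sup (inner_sup O).2); exists C. Qed.

Lemma inner_open_le O (t : R) :
  (forall C, closed C -> C `<=` O -> m C <= t) -> inner_open O <= t.
Proof.
move=> h; apply: ge_sup; first exact: (inner_sup O).1.
by move=> _ [C [cC CO] <-]; exact: h.
Qed.

Lemma inner_open_ge0 O : 0 <= inner_open O.
Proof. by rewrite -m0 inner_open_ge//; exact: closed0. Qed.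

Lemma inner_open_mono O B : O `<=` B -> inner_open O <= inner_open B.
Proof.
move=> OB; apply: inner_open_le => C cC CO.
by apply: inner_open_ge => //; exact: subset_trans OB.
Qed.

Lemma inner_open0 : inner_open set0 = 0.
Proof.
apply/eqP; rewrite eq_le inner_open_ge0 andbT; apply: inner_open_le => C _.
by rewrite subset0 => ->; rewrite m0.
Qed.

Lemma inner_openT : inner_open setT = 1.
Proof.
apply/eqP; rewrite eq_le; apply/andP; split.
  by apply: inner_open_le => C _ _; rewrite -mT m_le.
by rewrite -mT inner_open_ge//; exact: closedT.
Qed.

(** By normality a closed subset of a union of two open sets is the union of
    closed subsets of the two. *)
Lemma inner_openU O B : open O -> open B ->
  inner_open (O `|` B) <= inner_open O + inner_open B.
Proof.
move=> oO oB; apply: inner_open_le => C cC CO.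
have cCB : closed (C `\` B) by apply: closedD.
have nO : set_nbhs (C `\` B) O.
  apply/set_nbhsP; exists O; split => // x [/CO[]//].
have [U /set_nbhsP[W [oW CW WU]] clU] := compact_normal hT cT cCB nO.
have -> : C = (C `&` closure W) `|` (C `\` W).
  apply/seteqP; split => [x Cx|x [[]|[]]//].
  have [Wx|nWx] := pselect (W x); last by right.
  by left; split => //; exact: subset_closure.
apply: le_trans (mU_le _ _) _; apply: lerD; apply: inner_open_ge.
- by apply: closedI => //; exact: closed_closure.
- by move=> x [_ /(closureS WU)/clU].
- exact: closedD.
- move=> x [Cx nWx]; have [Ox|//] := CO x Cx.
  by apply: contrapT => nBx; apply: nWx; apply: CW.
Qed.

(** By compactness only finitely many of the open sets matter for a given closed
    subset of their union. *)
Lemma inner_open_bigcup (F : (set T)^nat) : (forall n, open (F n)) ->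
  ((inner_open (\bigcup_n F n))%:E <= \sum_(n <oo) (inner_open (F n))%:E)%E.
Proof.
move=> oF.
have fin n : inner_open (\big[setU/set0]_(i < n) F i) <=
    \sum_(i < n) inner_open (F i).
  elim: n => [|n ih]; first by rewrite !big_ord0 inner_open0.
  rewrite !big_ord_recr/=; apply: le_trans (inner_openU _ (oF n)) _.
    by elim/big_ind : _ => //; [exact: open0|exact: openU].
  by rewrite lerD2r.
have pos n : xpredT n -> (0%N <= n)%N -> (0 <= (inner_open (F n))%:E)%E.
  by move=> _ _; rewrite lee_fin inner_open_ge0.
have big n : ((inner_open (\big[setU/set0]_(i < n) F i))%:E <=
    \sum_(n <oo) (inner_open (F n))%:E)%E.
  apply: le_trans (nneseries_lim_ge n _); last by move=> k _; apply: pos.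
  by rewrite sumEFin lee_fin big_mkord.
suff H C : closed C -> C `<=` \bigcup_n F n -> 
    ((m C)%:E <= \sum_(n <oo) (inner_open (F n))%:E)%E.
  case E : (\sum_(n <oo) _)%E H => [r| |] H; last 2 first.
  - by rewrite leey.
  - have : (0 <= \sum_(n <oo) (inner_open (F n))%:E)%E.
      by apply: nneseries_ge0 => n _; exact: pos.
    by rewrite E.
  - by rewrite lee_fin; apply: inner_open_le => C cC CF; rewrite -lee_fin H.
move=> cC CF.
have : compact C by exact: subclosed_compact cC cT _.
rewrite compact_cover => /(_ nat setT F (fun i _ => oF i)) [].
  by move=> x /CF[n _ Fx]; exists n.
move=> D _ CD.
pose N := (\max_(i <- finmap.enum_fset D) i).+1.
apply: le_trans (big N); rewrite lee_fin.
apply: inner_open_ge => // x /CD[i/= iD Fx].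
rewrite -bigcup_mkord; exists i => //=.
by rewrite ltnS; exact: leq_bigmax_seq.
Qed.

Definition outer_reg A : R :=
  inf [set inner_open O | O in [set O | open O /\ A `<=` O]].

Let outer_inf A :
  has_inf [set inner_open O | O in [set O | open O /\ A `<=` O]].
Proof.
split; first by exists (inner_open setT), setT => //; split => //; exact: openT.
by exists 0 => _ [C _ <-]; rewrite inner_open_ge0.
Qed.

Lemma outer_reg_le A O : open O -> A `<=` O -> outer_reg A <= inner_open O.
Proof. by move=> oO AO; apply: (inf_lbound (outer_inf A).2); exists O. Qed.

Lemma outer_reg_ge A (t : R) :
  (forall O, open O -> A `<=` O -> t <= inner_open O) -> t <= outer_reg A.
Proof.
move=> h; apply: lb_le_inf; first exact: (outer_inf A).1.
by move=> _ [C [cC CO] <-]; exact: h.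
Qed.

Lemma outer_reg_adherent A (e : R) : 0 < e ->
  exists O, [/\ open O, A `<=` O & inner_open O < outer_reg A + e].
Proof.
move=> e0; have [_ [U [oU AU] <-] lt] := inf_adherent e0 (outer_inf A).
by exists U.
Qed.

Lemma outer_reg_open O : open O -> outer_reg O = inner_open O.
Proof.
move=> oO; apply/eqP; rewrite eq_le outer_reg_le//=.
by apply: outer_reg_ge => B _; exact: inner_open_mono.
Qed.

Lemma outer_reg_ge0 A : 0 <= outer_reg A.
Proof. by apply: outer_reg_ge => O _ _; exact: inner_open_ge0. Qed.

Lemma outer_reg_mono A B : A `<=` B -> outer_reg A <= outer_reg B.
Proof.
move=> AB; apply: outer_reg_ge => O oO BO.
by apply: outer_reg_le => //; exact: subset_trans BO.
Qed.

Let nu A : \bar R := (outer_reg A)%:E.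

Let nu0 : nu set0 = 0%E.
Proof. by rewrite /nu outer_reg_open ?inner_open0//; exact: open0. Qed.

Let nu_ge0 A : (0 <= nu A)%E. Proof. by rewrite lee_fin outer_reg_ge0. Qed.

Let nu_mono : {homo nu : A B / A `<=` B >-> (A <= B)%E}.
Proof. by move=> A B AB; rewrite lee_fin outer_reg_mono. Qed.

Let nu_sub : sigma_subadditive nu.
Proof.
move=> F; apply/lee_addgt0Pr => e e0.
apply: le_trans (epsilon_trick xpredT (fun n => nu_ge0 (F n)) (ltW e0)).
have /choice[U HU] n : exists U, [/\ open U, F n `<=` U &
    inner_open U < outer_reg (F n) + e / (2 ^ n.+1)%:R].
  by apply: outer_reg_adherent; rewrite divr_gt0// ltr0n expn_gt0.
have oU n : open (U n) by have [] := HU n.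
apply: (@le_trans _ _ (inner_open (\bigcup_n U n))%:E).
  rewrite lee_fin; apply: outer_reg_le; first exact: bigcup_open.
  by apply: subset_bigcup => n _; have [] := HU n.
apply: le_trans (inner_open_bigcup oU) _.
apply: lee_nneseries => n _.
  by rewrite lee_fin inner_open_ge0.
by rewrite /nu -EFinD lee_fin ltW//; have [] := HU n.
Qed.

HB.instance Definition _ :=
  isOuterMeasure.Build R T nu nu0 nu_ge0 nu_mono nu_sub.

(** Given an open U, take C closed in U meet O, then C' closed in U minus C; the
    two are disjoint, and U minus C contains U minus O. *)
Let open_caratheodory O : open O -> nu.-caratheodory O.
Proof.
move=> oO; apply: le_caratheodory_measurable => X.
rewrite /nu -EFinD lee_fin; apply: outer_reg_ge => U oU XU.
apply: (@le_trans _ _ (outer_reg (U `&` O) + outer_reg (U `&` ~` O))).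
  by apply: lerD; apply: outer_reg_mono; exact: setSI.
rewrite (outer_reg_open (openI oU oO)) -lerBrDr.
apply: inner_open_le => C cC CUO; rewrite lerBrDr addrC -lerBrDr.
have oUC : open (U `\` C).
  by rewrite setDE; apply: openI => //; exact: closed_openC.
apply: (@le_trans _ _ (inner_open (U `\` C))).
  by apply: outer_reg_le => // x [Ux nOx]; split => // /CUO[].
apply: inner_open_le => C' cC' C'U; rewrite lerBrDr -mU.
  apply: inner_open_ge; first exact: closedU.
  by move=> x [/C'U[]//|/CUO[]].
by apply/seteqP; split => // x [/C'U[]].
Qed.

Let B := g_sigma_algebraType (@open T).

Let borel_caratheodory (A : set B) : measurable A -> nu.-caratheodory A.
Proof.
apply: smallest_sub; last exact: open_caratheodory.
split.
- exact: caratheodory_measurable_set0.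
- move=> X; rewrite setTD; exact: caratheodory_measurable_setC.
- exact: caratheodory_measurable_bigcup.
Qed.

Let mu (A : set B) : \bar R := nu A.

Let mu0 : mu set0 = 0%E. Proof. exact: nu0. Qed.
Let mu_ge0 A : (0 <= mu A)%E. Proof. exact: nu_ge0. Qed.
Let mu_sigma : semi_sigma_additive mu.
Proof.
move=> F mF tF mbF.
apply: (@caratheodory_measure_sigma_additive R T nu) => //.
- by move=> n; exact: borel_caratheodory.
- exact: borel_caratheodory.
Qed.

HB.instance Definition _ := isMeasure.Build _ _ _ mu mu0 mu_ge0 mu_sigma.

Let muT : mu setT = 1%E.
Proof. by rewrite /mu /nu outer_reg_open ?inner_openT//; exact: openT. Qed.

HB.instance Definition _ := Measure_isProbability.Build _ _ _ mu muT.

(** Inner regularity is outer regularity of the complement. *)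
Lemma regularization : exists mu : probability B R,
  borel_regular mu /\ forall C, closed C -> ((m C)%:E <= mu C)%E.
Proof.
have outer A :
    ereal_inf [set mu O | O in [set O : set T | open O /\ A `<=` O]] = mu A.
  apply/eqP; rewrite eq_le; apply/andP; split; last first.
    by apply: le_ereal_inf_tmp => _ [U [oU AU] <-]; exact: nu_mono.
  apply/lee_addgt0Pr => e e0.
  have [U [oU AU lt]] := outer_reg_adherent A e0.
  apply: (@le_trans _ _ (mu U)).
    by apply: ereal_inf_lbound; exists U.
  by rewrite /mu /nu -EFinD lee_fin (outer_reg_open oU) ltW.
exists mu; split => [A mA|].
- split; first exact: outer.
  apply/eqP; rewrite eq_le; apply/andP; split; last first.
    by apply: ge_ereal_sup => _ [U [oU AU] <-]; exact: nu_mono.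
  apply/lee_addgt0Pr => e e0.
  have [U [oU AU lt]] := outer_reg_adherent (~` A) e0.
  apply: (@le_trans _ _ (mu (~` U) + e%:E)%E); last first.
    rewrite leeD2r//; apply: ereal_sup_ubound; exists (~` U) => //.
    split; first exact: open_closedC.
    by rewrite -[X in _ `<=` X]setCK; exact: subsetC.
  have mU' : measurable (U : set B) by exact: sub_sigma_algebra.
  have EA : outer_reg (~` A) = 1 - outer_reg A.
    by apply: EFin_inj; exact: (probability_setC mu mA).
  have EU : outer_reg (~` U) = 1 - outer_reg U.
    by apply: EFin_inj; exact: (probability_setC mu mU').
  rewrite /mu /nu -EFinD lee_fin EU.
  by move: lt; rewrite -(outer_reg_open oU) EA; lra.
- move=> C cC; rewrite lee_fin; apply: outer_reg_ge => O oO CO.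
  exact: inner_open_ge.
Qed.

End regularization.

(** * The topology of the state space *)

Lemma ptws_cvg (U : Type) (V : topologicalType) (F : set_system {ptws U -> V})
    (f : {ptws U -> V}) : Filter F ->
  (forall t, (fun g : {ptws U -> V} => g t) @ F --> f t) -> F --> f.
Proof.
move=> FF h; apply/cvg_sup => t; apply/cvg_image.
  by rewrite eqEsubset; split => // v _; exists (cst v).
move=> W /h /= Ft; exists (@^~ t @^-1` W) => //.
by rewrite eqEsubset; split => [_ [? + <-//]|v Wv]; exists (fun=> v).
Qed.

Lemma ptws_eval_continuous (U : Type) (V : topologicalType) (t : U) :
  continuous (fun g : {ptws U -> V} => g t).
Proof.
move=> f; have /cvg_sup/(_ t)/cvg_image : f --> f by apply: cvg_id.
move=> h; apply: cvg_trans (h _) => {h}.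
  by move=> Q /= [W nbdW <-]; apply: filterS nbdW; exact: preimage_image.
by rewrite eqEsubset; split => y //; exists (fun=> y).
Qed.

(** A bounded real function converges along every ultrafilter: it has a cluster
    value by compactness, and an ultrafilter converges to its cluster values. *)
Lemma ultra_cvg_bounded (R : realType) (X : Type) (F : set_system X)
    (f : X -> R) (a b : R) : UltraFilter F -> F [set x | a <= f x <= b] ->
  exists l : R, f @ F --> l.
Proof.
move=> FU Fab.
have [l [_ fl]] : `[a, b] `&` cluster (f @ F) !=set0.
  have FP : ProperFilter (f @ F) by exact: fmap_proper_filter.
  apply: (@segment_compact R a b _ FP); rewrite /= /fmap/=.
  by apply: filterS Fab => x /=; rewrite in_itv.
exists l => A nA /=; rewrite nbhs_simpl.
have [//|FnA] := in_ultra_setVsetC (f @^-1` A) FU.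
by have [t [/= nAt At]] := fl (~` A) A FnA nA.
Qed.

Section state_space.
Context (R : realType) (d : Order.disp_t) (G : unitalPogroupType d).
Context (s : states R G).
Local Notation E := (Gamma G).
Local Notation u := (Gamma_top G).
Local Notation T := (pset_type s).

Lemma hat_continuous (a : E) : continuous (hat a : T -> R).
Proof.
move=> x; apply: (@continuous_comp T {ptws E -> R^o} R set_val (fun g => g a)).
  exact: initial_continuous.
exact: (@ptws_eval_continuous E R^o).
Qed.

Lemma cvg_state (F : set_system T) (x : T) : Filter F ->
  (forall a : E, hat a @ F --> (hat a x : R)) -> F --> x.
Proof.
move=> FF h A [_ [[B oB <-] Bx BA]].
have : set_val @ F --> (set_val x : {ptws E -> R^o}) by exact: ptws_cvg.
move=> /(_ B)/=; rewrite nbhs_simpl => H.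
by apply: filterS BA _; apply: H; exact: open_nbhs_nbhs.
Qed.

Lemma states_hausdorff : hausdorff_space T.
Proof.
move=> x y xy; apply: val_inj; apply/funext => a.
apply: (@Rhausdorff R) => A B nA nB.
have [z [/= Az Bz]] := xy _ _ (hat_continuous nA) (hat_continuous nB).
by exists (hat a z).
Qed.

(** The pointwise limits along an ultrafilter exist since the values lie in
    [0, 1], and they form a state. *)
Lemma states_compact : compact [set: T].
Proof.
rewrite compact_ultra => F FU _.
have lim a : exists l : R, hat a @ F --> l.
  apply: (@ultra_cvg_bounded R T F (hat a) 0 1 FU); apply: filterE => x /=.
  by have [/(_ a)] := set_valP x.
have [l Fl] := choice lim.
have ls : is_state l.
  split.
  - move=> a; apply/andP; split.
      apply: (@closed_cvg _ _ F _ (hat a) _ (@closed_ge R 0) _ _ (Fl a)).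
      by apply: filterE => x; have [/(_ a)/andP[]] := set_valP x.
    apply: (@closed_cvg _ _ F _ (hat a) _ (@closed_le R 1) _ _ (Fl a)).
    by apply: filterE => x; have [/(_ a)/andP[]] := set_valP x.
  - move=> a b c abc; apply: (@cvg_unique _ (@Rhausdorff R) _ _ _ _ (Fl c)).
    have -> : (hat c : T -> R) = hat a + hat b.
      by apply/funext => x; have [_ /(_ _ _ _ abc)] := set_valP x.
    by apply: (@cvgD _ R^o _ _ _ (hat a) (hat b)); exact: Fl.
  - apply: (@cvg_unique _ (@Rhausdorff R) _ _ _ _ (Fl u)).
    have -> : (hat u : T -> R) = cst 1.
      by apply/funext => x; have [] := set_valP x.
    exact: cvg_cst.
exists (SigSub (mem_set ls) : T); split => //.
by apply: cvg_state => a; exact: Fl.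
Qed.

End state_space.

(** * From positive functionals on bounded functions to regular measures *)

Definition bounded_fct (X : Type) (R : realType) (g : X -> R) :=
  exists M : R, forall x, `|g x| <= M.

Section compact_integral.
Context (R : realType) (T : ptopologicalType) (cT : compact [set: T]).
Local Notation B := (g_sigma_algebraType (@open T)).
Implicit Types (g h : T -> R) (mu : probability B R).

Lemma open_borel (O : set T) : open O -> measurable (O : set B).
Proof. exact: sub_sigma_algebra. Qed.

Lemma closed_borel (C : set T) : closed C -> measurable (C : set B).
Proof.
move=> cC; rewrite -[C]setCK; apply: measurableC.
exact: (open_borel (closed_openC cC)).
Qed.

Lemma continuous_borel g : continuous g -> measurable_fun [set: B] (g : B -> R).
Proof.
move=> /continuousP cg; apply: (measurability _ (RGenOpens.measurableE R)).
move=> _ [_ [a [b ->] <-]]; rewrite setTI.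
by apply: open_borel; apply: cg; exact: interval_open.
Qed.

Lemma continuous_bounded_fct g : continuous g -> bounded_fct g.
Proof.
move=> cg; have : compact (g @` setT).
  by apply: continuous_compact => //; exact: continuous_subspaceT.
move=> /(@compact_bounded R R^o)[M [_ h]].
exists (`|M| + 1) => x; apply: (h (`|M| + 1)); last by exists x.
by rewrite (le_lt_trans (ler_norm _))// ltrDl.
Qed.

Lemma bounded_fct_integrable mu (A : set B) g :
  measurable A -> measurable_fun A (g : B -> R) ->
  bounded_fct g -> mu.-integrable A (EFin \o (g : B -> R)).
Proof.
move=> mA mg [M gM]; apply: measurable_bounded_integrable => //.
  by rewrite (le_lt_trans (probability_le1 mu mA))// ltry.
exists M; split; rewrite ?num_real// => y My x _.
by apply: le_trans (gM x) (ltW My).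
Qed.

Lemma continuous_integrable mu (A : set B) g : measurable A -> continuous g ->
  mu.-integrable A (EFin \o (g : B -> R)).
Proof.
move=> mA cg; apply: bounded_fct_integrable => //.
  by apply: measurable_funTS; exact: continuous_borel.
exact: continuous_bounded_fct.
Qed.

Lemma indic_integrable mu (A : set B) : measurable A ->
  mu.-integrable [set: B] (EFin \o (\1_A : B -> R)).
Proof.
move=> mA; apply: bounded_fct_integrable => //.
exists 1 => x; rewrite indicE; case: (_ \in _) => /=; rewrite ?normr0 ?normr1//.
Qed.

Lemma Rintegral_prob_cst mu (k : R) : \int[mu]_x k = k.
Proof.
rewrite Rintegral_cst// -[RHS]mulr1; congr (_ * _).
exact: (congr1 fine (probability_setT mu)).
Qed.

(** A combination of indicators of closed superlevel sets of [g], within [e] of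
    [g] as soon as g lies between c and c + (n + 1) e. It transfers the
    inequality between a finitely additive and a Borel measure from closed sets
    to integrals. *)
Definition stairs (c e : R) n g (x : T) : R :=
  c + e * \sum_(k < n) \1_[set y | c + e *+ k.+1 <= g y] x.

Lemma stairsS c e n g x : stairs c e n.+1 g x =
  stairs c e n g x + (if c + e *+ n.+1 <= g x then e else 0).
Proof.
rewrite /stairs big_ord_recr/= mulrDr addrA; congr (_ + _).
rewrite indicE; case: ifPn => h; first by rewrite mem_set// mulr1.
by rewrite memNset ?mulr0//; exact/negP.
Qed.

(** The second alternative is the case of all n steps lying below g(x). *)
Lemma stairs_bounds c e n g x : 0 < e -> c <= g x ->
  [/\ stairs c e n g x <= g x, stairs c e n g x <= c + e *+ n &
      g x <= stairs c e n g x + e \/ c + e *+ n.+1 <= stairs c e n g x + e].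
Proof.
move=> e0 cg; elim: n => [|n [ih1 ih2 ih3]].
  by rewrite /stairs big_ord0 mulr0 mulr0n !addr0 mulr1n; split => //; right.
rewrite stairsS; case: ifPn => h.
  split; first by rewrite (le_trans _ h)// mulrSr addrA lerD2r.
    by rewrite mulrSr addrA lerD2r.
  case: ih3 => ih3; right; rewrite (mulrSr e n.+1); lra.
rewrite addr0; split => //; first by rewrite mulrSr; lra.
by case: ih3 => ih3; left => //; move: h; rewrite -ltNge; lra.
Qed.

End compact_integral.

Section riesz.
Context (R : realType) (T : ptopologicalType).
Context (hT : hausdorff_space T) (cT : compact [set: T]).
Local Notation B := (g_sigma_algebraType (@open T)).
Implicit Types (g h : T -> R).
Context (L : (T -> R) -> R).
Context (LD : forall g h, bounded_fct g -> bounded_fct h ->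
  L (g \+ h) = L g + L h).
Context (LZ : forall k g, bounded_fct g -> L (fun x => k * g x) = k * L g).
Context (L_ge0 : forall g, bounded_fct g -> (forall x, 0 <= g x) -> 0 <= L g).
Context (L1 : L (cst 1) = 1).

Let bounded_fctD g h : bounded_fct g -> bounded_fct h -> bounded_fct (g \+ h).
Proof.
move=> [M gM] [N hN]; exists (M + N) => x.
by rewrite (le_trans (ler_normD _ _))// lerD.
Qed.

Let bounded_fctZ (k : R) g : bounded_fct g -> bounded_fct (fun x => k * g x).
Proof. by move=> [M gM]; exists (`|k| * M) => x; rewrite normrM ler_wpM2l. Qed.

Let bounded_fct_cst (k : R) : bounded_fct (fun x : T => k).
Proof. by exists `|k|. Qed.

Let bounded_fct_indic (A : set T) : bounded_fct (\1_A : T -> R).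
Proof.
exists 1 => x; rewrite indicE.
by case: (_ \in _) => /=; rewrite ?normr0 ?normr1.
Qed.

Let L_le g h : bounded_fct g -> bounded_fct h ->
  (forall x, g x <= h x) -> L g <= L h.
Proof.
move=> bg bh gh.
rewrite -subr_ge0 -mulN1r -LZ// -LD//; last exact: bounded_fctZ.
apply: L_ge0 => [|x/=]; first by apply: bounded_fctD => //; exact: bounded_fctZ.
by rewrite mulN1r subr_ge0.
Qed.

Let L_cst (k : R) : L (fun=> k) = k.
Proof.
transitivity (L (fun x => k * cst 1 x)); last first.
  by rewrite LZ; [rewrite L1 mulr1|exact: (bounded_fct_cst 1)].
by congr L; apply/funext => x /=; rewrite mulr1.
Qed.

Lemma bounded_fct_stairs c e n g : bounded_fct (stairs c e n g).
Proof.
elim: n => [|n ih].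
  rewrite (_ : stairs _ _ _ _ = cst c); first exact: (bounded_fct_cst c).
  by apply/funext => x; rewrite /stairs big_ord0 mulr0 addr0.
rewrite (_ : stairs _ _ _ _ = stairs c e n g \+
    (fun x => e * \1_[set y | c + e *+ n.+1 <= g y] x)); last first.
  by apply/funext => x/=; rewrite /stairs big_ord_recr/= mulrDr addrA.
by apply: bounded_fctD => //; apply: bounded_fctZ; exact: bounded_fct_indic.
Qed.

(** As [L] is defined on all bounded functions, indicators included, it is an
    integral for the finitely additive probability A |-> L(1_A), which only has
    to be made regular. *)
Theorem functional_representation : exists mu : probability B R,
  borel_regular mu /\
  forall g, continuous g -> L g <= \int[mu]_x (g : B -> R) x.
Proof.
have [mu [rmu mC]] : exists mu : probability B R,
    borel_regular mu /\ forall C, closed C -> ((L \1_C)%:E <= mu C)%E.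
  apply: regularization => //.
  - by move=> A; apply: L_ge0.
  - move=> A A' AA'; rewrite -LD//; congr L; apply/funext => x /=.
    rewrite !indicE in_setU.
    have [xA|] := boolP (x \in A); last by rewrite add0r.
    have /negPf -> : x \notin A'; last by rewrite addr0.
    apply/negP => xA'; have : (A `&` A') x by split; exact: set_mem.
    by rewrite AA'.
  - by rewrite -[RHS]L1; congr L; apply/funext => x; rewrite indicT.
exists mu; split => // g cg.
have [M gM] := continuous_bounded_fct cT cg.
pose c := - M.
have cgx x : c <= g x by move: (gM x); rewrite ler_norml => /andP[].
have M0 : 0 <= M by apply: le_trans (gM point).
apply/ler_addgt0Pr => e e0.
have [n Mn] : exists n, M <= c + e *+ n.+1.
  have := archi_boundP (divr_ge0 (addr_ge0 M0 M0) (ltW e0)).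
  move: (Num.bound _) => n; rewrite ltr_pdivrMr// => Mn; exists n.
  by rewrite (mulrSr e n) -(mulr_natl e n) /c; lra.
have closedC k : closed [set y | c + e *+ k.+1 <= g y].
  rewrite (_ : mkset _ = g @^-1` [set t | c + e *+ k.+1 <= t])//.
  by apply: closed_comp => //; exact: closed_ge.
have H k : L (stairs c e k g) <= \int[mu]_x (stairs c e k g : B -> R) x /\
    mu.-integrable [set: B] (EFin \o (stairs c e k g : B -> R)).
  elim: k => [|k [ih1 ih2]].
    rewrite (_ : stairs _ _ _ _ = cst c); last first.
      by apply/funext => x; rewrite /stairs big_ord0 mulr0 addr0.
    split; last by apply: continuous_integrable => //; exact: cst_continuous.
    by rewrite L_cst Rintegral_prob_cst.
  have intC := indic_integrable mu (closed_borel (closedC k)).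
  pose i : B -> R := \1_[set y | c + e *+ k.+1 <= g y].
  have intC' : mu.-integrable [set: B] (EFin \o (fun x => e * i x)).
    rewrite (_ : _ \o _ = (fun x => e%:E * (EFin \o i) x)%E)//.
    exact: integrableZl.
  pose f : B -> R := stairs c e k g.
  rewrite (_ : stairs _ _ _ _ = f \+ (fun x => e * i x)); last first.
    by apply/funext => x/=; rewrite /f/i/stairs big_ord_recr/= mulrDr addrA.
  split; last first.
    rewrite (_ : _ \o _ =
      ((EFin \o f) \+ (EFin \o (fun x : B => (e * i x)%R)))%E)//.
    exact: integrableD.
  have bi : bounded_fct i by exact: bounded_fct_indic.
  rewrite LD//; [|exact: bounded_fct_stairs|exact: bounded_fctZ].
  rewrite RintegralD// lerD// LZ// RintegralZl// ler_wpM2l//; first exact: ltW.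
  rewrite -lee_fin; apply: le_trans (mC _ (closedC k)) _.
  have mCk := closed_borel (closedC k).
  rewrite /Rintegral integral_indic// setIT fineK//.
  exact: fin_num_measure.
have [H1 H2] := H n.
apply: (@le_trans _ _ (L (stairs c e n g \+ cst e))).
  apply: L_le.
  - by exists M.
  - by apply: bounded_fctD; [exact: bounded_fct_stairs|exact: bounded_fct_cst].
  - move=> x /=; have [_ _] := stairs_bounds n e0 (cgx x).
    case => // /(le_trans Mn); apply: le_trans.
    by move: (gM x); rewrite ler_norml => /andP[].
rewrite LD; [|exact: bounded_fct_stairs|exact: bounded_fct_cst].
rewrite L_cst lerD2r; apply: le_trans H1 _.
apply: le_Rintegral => //; first exact: continuous_integrable.
by move=> x _; have [] := stairs_bounds n e0 (cgx x).
Qed.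

End riesz.

(** * Decompositions of a state and the dominating measure *)

Section decompositions.
Context (R : realType) (d : Order.disp_t) (G : unitalPogroupType d).
Context (s : states R G).
Local Notation E := (Gamma G).
Local Notation u := (Gamma_top G).
Local Notation T := (pset_type s).
Local Notation V := {ptws E -> R^o}.
Implicit Types (y z w : E -> R) (D : seq (E -> R)).

(** The value [s] is a default; it occurs with weight z(u) = 0 only. *)
Definition normalized z : T :=
  if pselect (is_state (fun a => z a / z u)) is left h
  then SigSub (mem_set h : _ \in states R G) else s.

Lemma normalized_posadd z : posadd z -> z u != 0 ->
  forall a, hat a (normalized z) = z a / z u.
Proof.
move=> hz zu0 a.
have zu : 0 < z u by rewrite lt_neqAle eq_sym zu0 hz.1.
rewrite /normalized; case: pselect => // -[]; split.
- move=> b; rewrite divr_ge0 ?hz.1//= ler_pdivrMr// mul1r.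
  exact: posadd_le_top.
- by move=> b c e /Gamma_addP /hz.2 ->; rewrite mulrDl.
- by rewrite divff.
Qed.

Definition decomposition D :=
  {in D, forall z, posadd z} /\ \sum_(z <- D) z = \val s.

(** The integral of [g] against the finitely supported probability that [D]
    stands for. *)
Definition decomp_avg D (g : T -> R) := \sum_(z <- D) z u * g (normalized z).

Let sumE D a : (\sum_(z <- D) z) a = \sum_(z <- D) z a.
Proof.
elim: D => [|z D ih]; first by rewrite !big_nil.
by rewrite !big_cons -ih.
Qed.

Lemma decomposition_sum D a : decomposition D -> \sum_(z <- D) z a = hat a s.
Proof. by move=> [_ e]; rewrite /hat -e sumE. Qed.

Lemma decomposition_mass D : decomposition D -> \sum_(z <- D) z u = 1.
Proof. by move=> /decomposition_sum ->; have [] := set_valP s. Qed.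

Lemma decomposition1 : decomposition [:: \val s].
Proof.
split; last by rewrite big_seq1.
by move=> z; rewrite inE => /eqP ->; apply: state_posadd; exact: set_valP.
Qed.

Lemma decomp_avg1 g : decomp_avg [:: \val s] g = g s.
Proof.
have su : (\val s : E -> R) u = 1 by have [] := set_valP s.
have ps : posadd (\val s) by apply: state_posadd; exact: set_valP.
rewrite /decomp_avg big_seq1 su mul1r; congr g.
apply: val_inj; apply/funext => a.
have := @normalized_posadd _ ps; rewrite su oner_neq0 => /(_ isT a).
by rewrite divr1.
Qed.

(** z(u) f(z / z(u)) is the homogeneous extension of f to the cone, and a
    homogeneous convex function is subadditive. *)
Lemma cone_subadditive_convex (f : V -> R^o) :
  convex_function (states R G) f ->
  cone_subadditive (fun z => z u * f (\val (normalized z))).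
Proof.
move=> cf; split=> [|y z hy hz]; first by rewrite mul0r.
have [yu0|yu0] := eqVneq (y u) 0.
  by rewrite (posadd_top0 hy yu0) !add0r mul0r add0r.
have [zu0|zu0] := eqVneq (z u) 0.
  by rewrite (posadd_top0 hz zu0) !addr0 mul0r addr0.
have yu : 0 < y u by rewrite lt_neqAle eq_sym yu0 hy.1.
have zu : 0 < z u by rewrite lt_neqAle eq_sym zu0 hz.1.
have yzu : 0 < y u + z u by exact: addr_gt0.
have t0 : 0 <= y u / (y u + z u) by rewrite divr_ge0// ltW.
have t1 : y u / (y u + z u) <= 1 by rewrite ler_pdivrMr// mul1r lerDl ltW.
pose t : {i01 R} := Itv01 t0 t1.
have -> : \val (normalized (y + z)) =
    (\val (normalized y) : convex_lmodType V) <| t |> \val (normalized z).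
  apply/funext => a.
  rewrite [LHS](normalized_posadd (posaddD hy hz)); last exact: lt0r_neq0.
  transitivity (y u / (y u + z u) * hat a (normalized y) +
     (1 - y u / (y u + z u)) * hat a (normalized z)); last by [].
  rewrite !normalized_posadd//.
  rewrite -[(y + z) a]/(y a + z a) -[(y + z) u]/(y u + z u).
  by field; rewrite yu0 zu0 lt0r_neq0.
have := cf t (\val (normalized y)) (\val (normalized z))
  (valP (normalized y)) (valP (normalized z)).
rewrite -(ler_pM2l yzu) => /le_trans; apply.
set fy := f _; set fz := f _.
have -> : fy <| t |> fz =
  y u / (y u + z u) * fy + (1 - y u / (y u + z u)) * fz by [].
rewrite le_eqVlt; apply/orP; left; apply/eqP.
by field; rewrite lt0r_neq0.
Qed.

Lemma decomp_avg_refines D D' (f : V -> R^o) :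
  convex_function (states R G) f -> refines D D' ->
  decomp_avg D (f \o \val) <= decomp_avg D' (f \o \val).
Proof. by move=> /cone_subadditive_convex cf /(_ _ cf). Qed.

Lemma decomp_avgD D (g h : T -> R) :
  decomp_avg D (g \+ h) = decomp_avg D g + decomp_avg D h.
Proof. by rewrite -big_split; apply: eq_bigr => z _; rewrite /= mulrDr. Qed.

Lemma decomp_avgZ D k (g : T -> R) :
  decomp_avg D (fun x => k * g x) = k * decomp_avg D g.
Proof.
by rewrite /decomp_avg mulr_sumr; apply: eq_bigr => z _; rewrite mulrCA.
Qed.

Lemma decomp_avg_ge0 D (g : T -> R) : decomposition D -> (forall x, 0 <= g x) ->
  0 <= decomp_avg D g.
Proof.
move=> hD g0; rewrite /decomp_avg big_seq; apply: sumr_ge0 => z /hD.1 hz.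
by rewrite mulr_ge0// hz.1.
Qed.

Lemma decomp_avg_cst D k : decomposition D -> decomp_avg D (cst k) = k.
Proof.
by move=> hD; rewrite /decomp_avg /= -mulr_suml decomposition_mass// mul1r.
Qed.

Lemma decomp_avg_bounded D (g : T -> R) M : decomposition D ->
  (forall x, `|g x| <= M) -> - M <= decomp_avg D g <= M.
Proof.
move=> hD gM; have := @decomp_avg_ge0 D (g \+ cst M) hD.
have := @decomp_avg_ge0 D ((fun x => -1 * g x) \+ cst M) hD.
rewrite !decomp_avgD decomp_avgZ decomp_avg_cst// => h1 h2.
apply/andP; split.
  by rewrite -subr_ge0 opprK h2// => x /=; move: (gM x); rewrite ler_norml; lra.
rewrite -subr_ge0 -mulN1r addrC h1// => x /=.
by move: (gM x); rewrite ler_norml; lra.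
Qed.

Definition refinement_base (D : {D | decomposition D}) : set (seq (E -> R)) :=
  [set D' | decomposition D' /\ refines (sval D) D'].

(** The limit of the averages along an ultrafilter finer than the filter of
    refinements, a filter thanks to [common_refinement]. For convex f the
    averages increase along refinement, so the limit dominates all of them. *)
Lemma exists_limit_functional : RDP G -> exists L : (T -> R) -> R,
  [/\ forall g h, bounded_fct g -> bounded_fct h -> L (g \+ h) = L g + L h,
      forall k g, bounded_fct g -> L (fun x => k * g x) = k * L g,
      forall g, bounded_fct g -> (forall x, 0 <= g x) -> 0 <= L g,
      L (cst 1) = 1 &
      forall D f, decomposition D -> bounded_fct (f \o (\val : T -> V)) ->
        convex_function (states R G) f ->
        decomp_avg D (f \o \val) <= L (f \o \val)].
Proof.
move=> rdp.
pose F := filter_from [set: {D | decomposition D}] refinement_base.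
have FF : ProperFilter F.
  apply: filter_from_proper.
    apply: filter_from_filter.
      by exists (exist _ _ decomposition1).
    move=> [D hD] [D' hD'] _ _.
    have [D'' [h1 h2 r1 r2]] := common_refinement rdp hD.1 hD'.1
      (etrans hD.2 (esym hD'.2)).
    have hD'' : decomposition D'' by split => //; rewrite h2 hD.2.
    exists (exist _ D'' hD'') => // X [hX rX]; split; split => //= f cf.
      exact: le_trans (r1 _ cf) (rX _ cf).
    exact: le_trans (r2 _ cf) (rX _ cf).
  by move=> [D hD] _; exists D; split.
have [U [UU FU]] := ultraFilterLemma FF.
have Udec : U decomposition.
  by apply: FU; exists (exist _ _ decomposition1) => // D [].
have lim g : exists l : R, bounded_fct g -> decomp_avg ^~ g @ U --> l.
  have [[M gM]|nb] := pselect (bounded_fct g); last by exists 0.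
  have [l] := @ultra_cvg_bounded R _ U (decomp_avg ^~ g) (- M) M UU
    (filterS (fun D hD => decomp_avg_bounded hD gM) Udec).
  by exists l.
have [L HL] := choice lim.
have PU : ProperFilter U by exact: ultra_proper.
have uniq g l : bounded_fct g -> decomp_avg ^~ g @ U --> l -> L g = l.
  by move=> bg; apply: (@cvg_unique _ (@Rhausdorff R)); exact: HL.
exists L; split.
- move=> g h bg bh; apply: uniq.
    move: bg bh => [M gM] [N hN]; exists (M + N) => x.
    by rewrite (le_trans (ler_normD _ _))// lerD.
  under eq_fun do rewrite decomp_avgD.
  by apply: (@cvgD _ R^o); exact: HL.
- move=> k g bg; apply: uniq.
    by move: bg => [M gM]; exists (`|k| * M) => x; rewrite normrM ler_wpM2l.
  under eq_fun do rewrite decomp_avgZ.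
  apply: (@cvgM R _ U _ (cst k) (decomp_avg ^~ g)); last exact: HL.
  exact: cvg_cst.
- move=> g bg g0.
  apply: (@closed_cvg _ _ U _ (decomp_avg ^~ g) _ (@closed_ge R 0) _ _
    (HL _ bg)).
  by apply: filterS Udec => D hD; exact: decomp_avg_ge0.
- apply: uniq; first by exists 1 => x; rewrite normr1.
  apply: cvg_near_cst.
  by apply: filterS Udec => D hD; exact: decomp_avg_cst.
- move=> D f hD bf cf.
  apply: (@closed_cvg _ _ U _ (decomp_avg ^~ (f \o \val)) _
    (@closed_ge R (decomp_avg D (f \o \val))) _ _ (HL _ bf)).
  apply: FU; exists (exist _ _ hD) => // D' [_ r].
  exact: decomp_avg_refines.
Qed.

Lemma within_continuous_val (f : V -> R^o) :
  {within states R G, continuous f} -> continuous (f \o \val : T -> R).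
Proof. by move=> /subspace_sigL_continuousP. Qed.

Lemma exists_dominating_measure : RDP G ->
  exists mu : probability (borel_type s) R,
  regular mu /\ forall D f, decomposition D ->
    {within states R G, continuous f} -> convex_function (states R G) f ->
    decomp_avg D (f \o \val) <= \int[mu]_x f (\val x).
Proof.
move=> rdp; have [L [LD LZ L0 L1 Lf]] := exists_limit_functional rdp.
have [mu [rmu Lmu]] := functional_representation (@states_hausdorff _ _ _ s)
  (@states_compact _ _ _ s) LD LZ L0 L1.
exists mu; split; first exact: rmu.
move=> D f hD /within_continuous_val contf cf.
apply: le_trans (Lf D f hD _ cf) (Lmu _ contf).
by apply: continuous_bounded_fct contf; exact: states_compact.
Qed.

End decompositions.

(** * Measures with barycentre s are limits of decompositions *)

Section barycentres.
Context (R : realType) (d : Order.disp_t) (G : unitalPogroupType d).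
Context (s : states R G).
Local Notation E := (Gamma G).
Local Notation u := (Gamma_top G).
Local Notation T := (pset_type s).
Local Notation V := {ptws E -> R^o}.
Implicit Types (x y : T) (l : seq E) (e : R).

Definition box x l e : set T :=
  [set y | forall a, a \in l -> `|hat a y - hat a x| <= e].

Lemma box0 x e : box x [::] e = setT.
Proof. by apply/seteqP. Qed.

Lemma box_cons x a l e :
  box x (a :: l) e = [set y | `|hat a y - hat a x| <= e] `&` box x l e.
Proof.
apply/seteqP; split => y /=.
  move=> h; split; first by apply: h; rewrite mem_head.
  by move=> b bl; apply: h; rewrite in_cons bl orbT.
by move=> [h1 h2] b; rewrite in_cons => /orP[/eqP ->|/h2].
Qed.

Lemma dist_hat_continuous a (c : R) : continuous (fun y : T => `|hat a y - c|).
Proof.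
move=> y.
apply: (@continuous_comp _ R^o R (fun y => hat a y - c) (fun t => `|t|)).
  apply: (@continuousB _ R^o) => //; last exact: cst_continuous.
  exact: hat_continuous.
exact: norm_continuous.
Qed.

Lemma closed_box x l e : closed (box x l e).
Proof.
elim: l => [|a l ih]; first by rewrite box0; exact: closedT.
rewrite box_cons; apply: closedI => //.
rewrite (_ : mkset _ =
  (fun y : T => `|hat a y - hat a x|) @^-1` [set t | t <= e])//.
apply: closed_comp; last exact: closed_le.
by move=> y _; exact: dist_hat_continuous.
Qed.

Lemma nbhs_box x l e : 0 < e -> nbhs x (box x l e).
Proof.
move=> e0; elim: l => [|a l ih]; first by rewrite box0; exact: filterT.
rewrite box_cons; apply: filterI => //.
have := @hat_continuous _ _ _ s a x => /(@cvgrPdist_le _ R^o)/(_ e e0).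
by apply: filterS => y; rewrite distrC.
Qed.

(** The boxes generate a filter along which every [hat a] converges to its value
    at x, hence one finer than the neighbourhoods of x in the topology of
    pointwise convergence. *)
Lemma box_base x (A : set T) : nbhs x A ->
  exists l e, 0 < e /\ box x l e `<=` A.
Proof.
pose F := filter_from [set p : seq E * R | 0 < p.2] (fun p => box x p.1 p.2).
have FF : Filter F.
  apply: filter_from_filter; first by exists ([::], 1) => /=.
  move=> [l e] [l' e'] /= e0 e0'; exists (l ++ l', Num.min e e') => /=.
    by rewrite lt_min e0.
  move=> y h; split => a al.
    have := h a; rewrite mem_cat al => /(_ isT)/le_trans; apply.
    by rewrite ge_min lexx.
  have := h a; rewrite mem_cat al orbT => /(_ isT)/le_trans; apply.
  by rewrite ge_min lexx orbT.
have Fx : F --> x.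
  apply: cvg_state => a; apply/(@cvgrPdist_le _ R^o) => e e0.
  by exists ([:: a], e) => //= y /(_ a); rewrite mem_head distrC => /(_ isT).
by move=> /Fx [[l e] /= e0 h]; exists l, e.
Qed.

Section barycentre_of_set.
Variable nu : probability (borel_type s) R.
Implicit Types A : set (borel_type s).

Let hat_int A a : measurable A -> nu.-integrable A (EFin \o (hat a : T -> R)).
Proof.
move=> mA; apply: continuous_integrable => //; first exact: states_compact.
exact: hat_continuous.
Qed.

Let cst_int A (k : R) : measurable A ->
  nu.-integrable A (EFin \o (fun _ : T => k)).
Proof.
move=> mA; apply: continuous_integrable => //; first exact: states_compact.
exact: cst_continuous.
Qed.

(** The mass of A times the barycentre of the measure restricted to A. *)
Definition set_moment A : E -> R := fun a => \int[nu]_(x in A) hat a x.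

Lemma posadd_set_moment A : measurable A -> posadd (set_moment A).
Proof.
move=> mA; split=> [a|a b c /Gamma_addP abc].
  by apply: Rintegral_ge0 => x _; have [/(_ a)/andP[]] := set_valP x.
rewrite /set_moment -RintegralD//; try exact: hat_int.
apply: eq_Rintegral => x _; rewrite /hat.
by have [_ /(_ _ _ _ abc)] := set_valP x.
Qed.

Lemma set_moment_top A : measurable A -> set_moment A u = fine (nu A).
Proof.
move=> mA; rewrite -[RHS]mul1r -Rintegral_cst//; apply: eq_Rintegral => x _.
by have [] := set_valP x.
Qed.

Lemma set_momentU A A' : measurable A -> measurable A' -> [disjoint A & A'] ->
  set_moment (A `|` A') = set_moment A + set_moment A'.
Proof.
move=> mA mA' AA'; apply/funext => a; apply: Rintegral_setU => //.
by apply: hat_int; exact: measurableU.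
Qed.

Lemma set_moment0 : set_moment set0 = 0.
Proof. by apply/funext => a; exact: Rintegral_set0. Qed.

(** A box is an intersection of slabs, so it contains the barycentre of any part
    of it; the barycentre of a state-valued measure exists by mere integration
    of the coordinates. *)
Lemma set_moment_box A x l e : measurable A -> A `<=` box x l e ->
  set_moment A u != 0 -> box x l e (normalized s (set_moment A)).
Proof.
move=> mA Ab zu0 a al.
have pz := posadd_set_moment mA.
have zu : 0 < set_moment A u by rewrite lt_neqAle eq_sym zu0 pz.1.
rewrite normalized_posadd// ler_distl ler_pdivlMr// ler_pdivrMr//.
rewrite set_moment_top// -!Rintegral_cst//.
apply/andP; split; apply: le_Rintegral => //;
  try exact: hat_int; try exact: cst_int.
  by move=> y /Ab/(_ _ al); rewrite ler_distl => /andP[].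
by move=> y /Ab/(_ _ al); rewrite ler_distl => /andP[].
Qed.

(** On the box, [g] differs from g(x) by at most r, both on A and at the
    barycentre of A. *)
Lemma le_barycentre_box A x l e (g : T -> R) (r : R) : continuous g ->
  measurable A -> A `<=` box x l e ->
  (forall y, box x l e y -> `|g y - g x| <= r) ->
  \int[nu]_(y in A) (g : borel_type s -> R) y <=
    set_moment A u * g (normalized s (set_moment A)) + (r + r) * fine (nu A).
Proof.
move=> cg mA Ab osc; rewrite set_moment_top//.
have gint : nu.-integrable A (EFin \o (g : borel_type s -> R)).
  by apply: continuous_integrable => //; exact: states_compact.
apply: (@le_trans _ _ ((g x + r) * fine (nu A))).
  rewrite -Rintegral_cst//; apply: le_Rintegral => //; first exact: cst_int.
  by move=> y /Ab/osc; rewrite ler_distl => /andP[].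
have [nuA0|nuA0] := eqVneq (fine (nu A)) 0.
  by rewrite nuA0 !(mulr0,mul0r) addr0.
rewrite [leLHS]mulrC [(r + r) * _]mulrC -mulrDr ler_wpM2l ?fine_ge0//.
have := set_moment_box mA Ab; rewrite set_moment_top// => /(_ nuA0)/osc.
by rewrite ler_distl; lra.
Qed.

(** The boxes around the points of [X] are made disjoint by removing them from A
    one after the other. *)
Lemma barycentre_partition (g : T -> R) (r : R) (N : T -> seq E * R) (X : seq T)
    A : continuous g ->
  (forall x y, box x (N x).1 (N x).2 y -> `|g y - g x| <= r) ->
  measurable A ->
  (forall y, A y -> exists2 x, x \in X & box x (N x).1 (N x).2 y) ->
  exists D, [/\ {in D, forall z, posadd z}, \sum_(z <- D) z = set_moment A &
    \int[nu]_(y in A) (g : borel_type s -> R) y <=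
      decomp_avg D g + (r + r) * fine (nu A)].
Proof.
move=> cg osc; elim: X A => [|x X ih] A mA AX.
  have -> : A = set0 by apply/seteqP; split => // y /AX[].
  exists [::]; rewrite big_nil set_moment0; split => //.
  by rewrite Rintegral_set0 /decomp_avg big_nil measure0 mulr0 addr0.
have mN : measurable (box x (N x).1 (N x).2 : set (borel_type s)).
  by apply: closed_borel; exact: closed_box.
pose N' : set (borel_type s) := box x (N x).1 (N x).2.
have mA1 : measurable (A `&` N') by exact: measurableI.
have mA2 : measurable (A `\` N') by exact: measurableD.
have AE : (A `&` N') `|` (A `\` N') = A by rewrite setUIDK.
have dis : [disjoint A `&` N' & A `\` N'].
  by apply/eqP/seteqP; split => // y [[_ ?] [_]].
have [|D [hD sD leD]] := ih _ mA2.
  move=> y [/AX[x']]; rewrite in_cons => /orP[/eqP ->//|x'X] b _.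
  by exists x'.
exists (set_moment (A `&` N') :: D); split.
- by move=> z; rewrite in_cons => /orP[/eqP->|/hD//]; exact: posadd_set_moment.
- by rewrite big_cons sD -[in RHS]AE set_momentU.
- have nuE : fine (nu A) = fine (nu (A `&` N')) + fine (nu (A `\` N')).
    by rewrite -!set_moment_top// -[in LHS]AE set_momentU.
  rewrite -[in leLHS]AE Rintegral_setU//; last first.
    by rewrite AE; apply: continuous_integrable => //; exact: states_compact.
  have := @le_barycentre_box _ x (N x).1 (N x).2 g r cg mA1
    (@subIsetr _ _ _) (osc x).
  rewrite nuE /decomp_avg big_cons -/(decomp_avg D g); move: leD.
  lra.
Qed.

Lemma hat_Aff a : Aff (states R G) (fun v : V => v a).
Proof.
split.
  by apply: continuous_subspaceT => v; exact: (@ptws_eval_continuous E R^o).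
by [].
Qed.

Lemma set_momentT : Aff_equiv nu (dirac (s : borel_type s)) ->
  set_moment setT = \val s.
Proof.
move=> h; apply/funext => a; have := h _ (hat_Aff a).
rewrite integral_dirac//.
  by rewrite diracT mul1e /set_moment /Rintegral => ->.
apply/measurable_EFinP; apply: continuous_borel; exact: hat_continuous.
Qed.

Lemma decomposition_approx (g : T -> R) (r : R) : continuous g -> 0 < r ->
  Aff_equiv nu (dirac (s : borel_type s)) ->
  exists2 D, decomposition s D &
    \int[nu]_y (g : borel_type s -> R) y <= decomp_avg D g + r.
Proof.
move=> cg r0 nus.
have r2 : 0 < r / 2 by rewrite divr_gt0.
have /choice[N HN] x : exists p : seq E * R,
    0 < p.2 /\ box x p.1 p.2 `<=` [set y | `|g y - g x| <= r / 2].
  have := cg x => /(@cvgrPdist_le _ R^o)/(_ _ r2) nx.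
  have [|l [e [e0 le]]] := @box_base x [set y | `|g y - g x| <= r / 2].
    by apply: filterS nx => y; rewrite distrC.
  by exists (l, e).
have := @states_compact _ _ _ s; rewrite compact_cover.
move=> /(_ T setT (fun x => interior (box x (N x).1 (N x).2))) [].
- by move=> x _; exact: open_interior.
- by move=> x _; exists x => //; apply: nbhs_box; have [] := HN x.
move=> X _ cover.
have [|||D [hD sD leD]] :=
  @barycentre_partition g (r / 2) N (finmap.enum_fset X) setT cg.
- by move=> x y /(HN x).2.
- exact: measurableT.
- by move=> y _; have [x /= xX /interior_subset b] := cover y I; exists x.
exists D; first by split => //; rewrite sD set_momentT.
apply: le_trans leD _; rewrite lerD2l.
rewrite -splitr (_ : nu setT = 1%E) ?mulr1//; exact: probability_setT.
Qed.

End barycentre_of_set.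
End barycentres.

(** * Regular measures are determined by convex functions *)

Section convex_continuous.
Context (R : realType) (d : Order.disp_t) (G : unitalPogroupType d).
Local Notation E := (Gamma G).
Local Notation V := {ptws E -> R^o}.
Local Notation K := (states R G).
Implicit Types (f g : V -> R^o).

Definition convex_continuous f :=
  {within K, continuous f} /\ convex_function K f.

Let convE (a b : R^o) (t : {i01 R}) :
  a <| t |> b = t%:num * a + (1 - t%:num) * b.
Proof. by []. Qed.

Lemma convex_continuous_cst (c : R) : convex_continuous (fun=> c).
Proof.
split; first by apply: continuous_subspaceT => x; exact: cst_continuous.
by move=> t x y _ _; rewrite convE le_eqVlt; apply/orP; left; apply/eqP; ring.
Qed.

Lemma convex_continuousD f g : convex_continuous f -> convex_continuous g ->
  convex_continuous (fun v => f v + g v).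
Proof.
move=> [cf vf] [cg vg]; split.
  by move=> x; apply: (@continuousD _ R^o); [exact: cf|exact: cg].
move=> t x y xK yK; apply: le_trans (lerD (vf t x y xK yK) (vg t x y xK yK)) _.
by rewrite !convE le_eqVlt; apply/orP; left; apply/eqP; ring.
Qed.

Lemma convex_continuousZ (k : R) f : 0 <= k -> convex_continuous f ->
  convex_continuous (fun v => k * f v).
Proof.
move=> k0 [cf vf]; split.
  by move=> x; apply: (@continuousM R); [exact: cst_continuous|exact: cf].
move=> t x y xK yK; apply: le_trans (ler_wpM2l k0 (vf t x y xK yK)) _.
by rewrite !convE le_eqVlt; apply/orP; left; apply/eqP; ring.
Qed.

Lemma convex_continuous_max f g : convex_continuous f -> convex_continuous g ->
  convex_continuous (fun v => Num.max (f v) (g v)).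
Proof.
move=> [cf vf] [cg vg]; split.
  by move=> x; apply: continuous_max; [exact: cf|exact: cg].
move=> t x y xK yK; have := vf t x y xK yK; have := vg t x y xK yK.
rewrite !convE => h1 h2.
have t0 : 0 <= t%:num :> R by [].
have t1 : 0 <= 1 - t%:num :> R by rewrite subr_ge0.
rewrite ge_max; apply/andP; split.
  by apply: le_trans h2 _; rewrite lerD// ler_wpM2l// le_max lexx.
by apply: le_trans h1 _; rewrite lerD// ler_wpM2l// le_max lexx orbT.
Qed.

Lemma convex_continuous_dist (a : E) (c : R) :
  convex_continuous (fun v : V => `|v a - c|).
Proof.
split.
  apply: continuous_subspaceT => v.
  apply: (@continuous_comp _ R^o R (fun v : V => v a - c) (fun t => `|t|)).
    apply: (@continuousB _ R^o) => //; last exact: cst_continuous.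
    exact: (@ptws_eval_continuous E R^o).
  exact: norm_continuous.
move=> t x y _ _; rewrite convE.
have t0 : 0 <= t%:num :> R by [].
have t1 : 0 <= 1 - t%:num :> R by rewrite subr_ge0.
rewrite -[X in _ <= X * _ + _](ger0_norm t0).
rewrite -[X in _ <= _ + X * _](ger0_norm t1).
rewrite -!normrM; apply: le_trans (ler_normD _ _).
rewrite (_ : (x <| t |> y) a = t%:num * x a + (1 - t%:num) * y a)//.
by rewrite le_eqVlt; apply/orP; left; apply/eqP; congr `|_|; ring.
Qed.

Lemma convex_continuous_sum_dist (l : seq E) (c : E -> R) :
  convex_continuous (fun v : V => \sum_(a <- l) `|v a - c a|).
Proof.
elim: l => [|a l ih].
  rewrite (_ : (fun _ => _) = (fun=> 0)); first exact: convex_continuous_cst.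
  by apply/funext => v; rewrite big_nil.
rewrite (_ : (fun _ => _) =
    (fun v => `|v a - c a| + \sum_(a <- l) `|v a - c a|)); last first.
  by apply/funext => v; rewrite big_cons.
by apply: convex_continuousD => //; exact: convex_continuous_dist.
Qed.

End convex_continuous.

Section difference_of_convex.
Context (R : realType) (d : Order.disp_t) (G : unitalPogroupType d).
Context (s : states R G).
Local Notation E := (Gamma G).
Local Notation T := (pset_type s).
Local Notation V := {ptws E -> R^o}.
Implicit Types (f : V -> R^o) (g h : T -> R).

(** These functions form a vector lattice, and they separate closed sets from
    points, enough to replace arbitrary continuous functions when comparing two
    regular measures. *)
Definition diff_convex g := exists f1 f2,
  [/\ convex_continuous f1, convex_continuous f2 &
      forall x, g x = f1 (\val x) - f2 (\val x)].

Lemma diff_convex_cst c : diff_convex (cst c).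
Proof.
exists (fun=> c), (fun=> 0); split; try exact: convex_continuous_cst.
by move=> x; rewrite subr0.
Qed.

Lemma diff_convex_opp g : diff_convex g -> diff_convex (fun x => - g x).
Proof.
move=> [f1 [f2 [h1 h2 gE]]]; exists f2, f1; split => // x.
by rewrite gE opprB.
Qed.

Lemma diff_convex_max g h : diff_convex g -> diff_convex h ->
  diff_convex (fun x => Num.max (g x) (h x)).
Proof.
move=> [f1 [f2 [h1 h2 gE]]] [f3 [f4 [h3 h4 hE]]].
exists (fun v => Num.max (f1 v + f4 v) (f3 v + f2 v)), (fun v => f2 v + f4 v).
split; last first.
- move=> x; rewrite gE hE; case: leP => h5; case: leP => h6; lra.
- exact: convex_continuousD.
- by apply: convex_continuous_max; exact: convex_continuousD.
Qed.

Lemma diff_convex_continuous g : diff_convex g -> continuous g.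
Proof.
move=> [f1 [f2 [[c1 _] [c2 _] gE]]].
have -> : g = (f1 \o \val) \- (f2 \o \val) by apply/funext.
by move=> x; apply: (@continuousB _ R^o); exact: within_continuous_val.
Qed.

(** On a box of radius e around x that lies in A, take 2 minus 2 / e times the
    sum of the distances of the coordinates to those of x; outside the box one
    of these distances exceeds e. *)
Lemma diff_convex_peak x (A : set T) : nbhs x A -> exists g,
  [/\ diff_convex g, g x = 2 & forall y, ~ A y -> g y <= 0].
Proof.
move=> /box_base[l [e [e0 bA]]].
exists (fun y => 2 - 2 / e * \sum_(a <- l) `|hat a y - hat a x|); split.
- exists (fun=> 2), (fun v => 2 / e * \sum_(a <- l) `|v a - hat a x|).
  split => //; first exact: convex_continuous_cst.
  apply: convex_continuousZ; first by rewrite divr_ge0// ltW.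
  exact: convex_continuous_sum_dist.
- by rewrite big1 ?mulr0 ?subr0// => a _; rewrite subrr normr0.
- move=> y nAy; have : ~ box x l e y by move=> /bA.
  move=> /existsNP[a /not_implyP[al /negP]]; rewrite -ltNge => lt.
  rewrite subr_le0 mulrAC -[leLHS]mulr1 -mulrA ler_pM2l// ler_pdivlMr// mul1r.
  apply: le_trans (ltW lt) _.
  rewrite (big_rem a)//= lerDl; exact: sumr_ge0.
Qed.

(** The maximum of 0 and of finitely many peaks, at points of C, that exceed 1
    on neighbourhoods covering C, cut off at 1. *)
Lemma diff_convex_urysohn (C O : set T) : closed C -> open O -> C `<=` O ->
  exists g,
  [/\ diff_convex g, forall x, 0 <= g x <= 1, forall x, C x -> g x = 1 &
      forall x, ~ O x -> g x = 0].
Proof.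
move=> cC oO CO.
have /choice[p Hp] x : exists g, C x ->
    [/\ diff_convex g, g x = 2 & forall y, ~ O y -> g y <= 0].
  have [Cx|nCx] := pselect (C x); last by exists (cst 0).
  have [|g hg] := @diff_convex_peak x O; last by exists g.
  by apply: open_nbhs_nbhs; split => //; exact: CO.
have : compact C by exact: subclosed_compact cC (@states_compact _ _ _ s) _.
rewrite compact_cover => /(_ T C (fun x => [set y | 1 < p x y])) [].
- move=> x /Hp[hd _ _].
  rewrite (_ : mkset _ = p x @^-1` [set t | 1 < t])//.
  apply: open_comp; last exact: open_gt.
  by move=> y _; exact: diff_convex_continuous.
- by move=> x Cx; exists x => //=; have [_ ->] := Hp x Cx; rewrite ltr1n.
move=> X XC cover.
have [g [dg g0 gp gO]] : exists g, [/\ diff_convex g, forall y, 0 <= g y,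
    forall x y, x \in finmap.enum_fset X -> p x y <= g y &
    forall y, ~ O y -> g y <= 0].
  have {cover XC} XC x : x \in finmap.enum_fset X -> C x.
    by move=> /XC; rewrite inE.
  elim: (finmap.enum_fset X) XC => [_|x X' ih XC].
    by exists (cst 0); split => //; exact: diff_convex_cst.
  have [|g [dg g0 gp gO]] := ih.
    by move=> y yX; apply: XC; rewrite in_cons yX orbT.
  have [dp _ pO] := Hp x (XC _ (mem_head _ _)).
  exists (fun y => Num.max (p x y) (g y)); split.
  - exact: diff_convex_max.
  - by move=> y; rewrite le_max g0 orbT.
  - move=> z y; rewrite in_cons => /orP[/eqP->|zX].
      by rewrite le_max lexx.
    by rewrite le_max gp// orbT.
  - by move=> y nOy; rewrite ge_max pO// gO.
exists (fun x => - Num.max (- 1) (- g x)); split.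
- apply: diff_convex_opp; apply: diff_convex_max.
    exact: diff_convex_cst.
  exact: diff_convex_opp.
- move=> x; rewrite -oppr_min !opprK le_min ge_min ler01 g0 lexx//.
- move=> x Cx; have [y /= yX py] := cover x Cx.
  have : 1 <= g x by apply: le_trans (ltW py) _; exact: gp.
  by rewrite -oppr_min !opprK => /min_idPl.
- move=> x nOx; have -> : g x = 0 by apply/le_anti; rewrite g0 gO.
  by rewrite -oppr_min !opprK; apply/min_idPr.
Qed.

End difference_of_convex.

Section uniqueness.
Context (R : realType) (d : Order.disp_t) (G : unitalPogroupType d).
Context (s : states R G).
Local Notation E := (Gamma G).
Local Notation T := (pset_type s).
Local Notation B := (borel_type s).
Local Notation V := {ptws E -> R^o}.
Implicit Types (mu nu : probability B R).

Lemma integral_Rintegral mu (g : T -> R) : continuous g ->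
  (\int[mu]_x ((g : B -> R) x)%:E)%E = (\int[mu]_x (g : B -> R) x)%:E.
Proof.
move=> cg; rewrite /Rintegral fineK//; apply: integrable_fin_num => //.
by apply: continuous_integrable => //; exact: states_compact.
Qed.

(** A Urysohn function lies between the two indicators and has the same integral
    for both measures. *)
Lemma closed_le_open mu nu (C O : set T) :
  (forall f : V -> R^o, convex_continuous f ->
    \int[mu]_x f (\val x) = \int[nu]_x f (\val x)) ->
  closed C -> open O -> C `<=` O -> (mu (C : set B) <= nu (O : set B))%E.
Proof.
move=> munu cC oO CO.
have [g [dg g01 gC gO]] := diff_convex_urysohn cC oO CO.
have contg := diff_convex_continuous dg.
have cK := @states_compact _ _ _ s.
have gint (m : probability B R) : m.-integrable setT (EFin \o (g : B -> R)).
  exact: continuous_integrable.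
have gE : \int[mu]_x (g : B -> R) x = \int[nu]_x (g : B -> R) x.
  case: dg => [f1 [f2 [h1 h2 gE]]].
  have c1 := @within_continuous_val _ _ _ s _ h1.1.
  have c2 := @within_continuous_val _ _ _ s _ h2.1.
  have H (m : probability B R) : \int[m]_x (g : B -> R) x =
      \int[m]_x f1 (\val (x : B)) - \int[m]_x f2 (\val (x : B)).
    rewrite -RintegralB//; try exact: (continuous_integrable cK).
    by apply: eq_Rintegral => x _; rewrite gE.
  by rewrite !H !munu.
have mC : measurable (C : set B) by exact: closed_borel.
have mO : measurable (O : set B) by exact: open_borel.
have CE (m : probability B R) (A : set B) : measurable A ->
    m A = (\int[m]_x (\1_A : B -> R) x)%:E.
  move=> mA; rewrite /Rintegral integral_indic// setIT fineK//.
  exact: fin_num_measure.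
rewrite !CE// lee_fin.
apply: (@le_trans _ _ (\int[mu]_x (g : B -> R) x)).
  apply: le_Rintegral => //; [exact: indic_integrable|exact: gint|].
  move=> x _; rewrite indicE; have [/set_mem/gC ->//|_] := boolP (x \in _).
  by case/andP: (g01 x).
rewrite gE; apply: le_Rintegral => //; [exact: gint|exact: indic_integrable|].
move=> x _; rewrite indicE; have [_|/negP nOx] := boolP (x \in _).
  by case/andP: (g01 x).
by rewrite gO// => Ox; apply: nOx; exact: mem_set.
Qed.

Lemma regular_eq mu nu : regular mu -> regular nu ->
  (forall f : V -> R^o, convex_continuous f ->
    \int[mu]_x f (\val x) = \int[nu]_x f (\val x)) ->
  borel_eq mu nu.
Proof.
have H m m' : regular (m : probability B R) -> regular (m' : probability B R) ->
    (forall f : V -> R^o, convex_continuous f ->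
      \int[m]_x f (\val x) = \int[m']_x f (\val x)) ->
    forall Y : set B, measurable Y -> (m Y <= m' Y)%E.
  move=> rm rm' mm' Y mY; rewrite (rm Y mY).2 -(rm' Y mY).1.
  apply: ge_ereal_sup => _ [C [cC CY] <-].
  apply: le_ereal_inf_tmp => _ [U [oU YU] <-].
  by apply: closed_le_open => //; exact: subset_trans YU.
move=> rmu rnu munu Y mY; apply/eqP; rewrite eq_le.
by apply/andP; split; apply: H => // f cf; rewrite munu.
Qed.

Lemma Aff_convex_continuous (f : V -> R^o) : Aff (states R G) f ->
  convex_continuous f /\ convex_continuous (fun v => - f v).
Proof.
move=> [cf af]; split; split => //.
- by move=> t x y xK yK; rewrite af.
- by move=> x; apply: (@continuousN _ R^o); exact: cf.
- by move=> t x y xK yK; rewrite af// convN.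
Qed.

Lemma choquet_leP mu nu : choquet_le mu nu <->
  forall f : V -> R^o, convex_continuous f ->
    \int[mu]_x f (\val x) <= \int[nu]_x f (\val x).
Proof.
split => [h f [cf vf]|h f cf vf].
  have := h f cf vf; have := @within_continuous_val _ _ _ s _ cf => contf.
  by rewrite !(integral_Rintegral _ contf) lee_fin.
have := @within_continuous_val _ _ _ s _ cf => contf.
by rewrite !(integral_Rintegral _ contf) lee_fin; exact: h.
Qed.

Lemma Aff_equivP mu nu : Aff_equiv mu nu <->
  forall f : V -> R^o, Aff (states R G) f ->
    \int[mu]_x f (\val x) = \int[nu]_x f (\val x).
Proof.
split => h f Af; have := h f Af;
  have := @within_continuous_val _ _ _ s _ Af.1 => contf.
  by rewrite !(integral_Rintegral _ contf) => -[].
by rewrite !(integral_Rintegral _ contf) => ->.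
Qed.

Lemma RintegralN_continuous mu (g : T -> R) : continuous g ->
  \int[mu]_x (- (g : B -> R) x) = - \int[mu]_x (g : B -> R) x.
Proof.
move=> cg; rewrite -mulN1r -RintegralZl//.
  by apply: eq_Rintegral => x _; rewrite mulN1r.
by apply: continuous_integrable => //; exact: states_compact.
Qed.

(** An affine function and its opposite are both convex. *)
Lemma choquet_le_Aff_equiv mu nu : choquet_le mu nu -> Aff_equiv mu nu.
Proof.
move=> /choquet_leP h; apply/Aff_equivP => f Af.
have [cf cNf] := Aff_convex_continuous Af.
have := h _ cNf; have contf := @within_continuous_val _ _ _ s _ cf.1.
rewrite !(RintegralN_continuous _ contf) lerN2 => le.
by apply/eqP; rewrite eq_le le h.
Qed.

Lemma Rintegral_dirac (g : T -> R) : continuous g ->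
  \int[dirac (s : B)]_x (g : B -> R) x = g s.
Proof.
move=> cg; rewrite /Rintegral integral_dirac//; first by rewrite diracT mul1e.
by apply/measurable_EFinP; exact: continuous_borel.
Qed.

End uniqueness.

Theorem theorem5p3 (R : realType) (d : Order.disp_t) (G : unitalPogroupType d)
    (hG : RDP G) (s : states R G) :
  exists mu : probability (borel_type s) R,
    [/\ maximal mu,
        Aff_equiv mu (dirac (s : borel_type s))
      & forall a : Gamma G, ((hat a s)%:E = \int[mu]_x (hat a x)%:E)%E] /\
    forall nu : probability (borel_type s) R,
      maximal nu ->
      Aff_equiv nu (dirac (s : borel_type s)) ->
      (forall a : Gamma G, ((hat a s)%:E = \int[nu]_x (hat a x)%:E)%E) ->
      borel_eq nu mu.
Proof.
have [mu [rmu dom]] := exists_dominating_measure s hG.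
pose delta : probability (borel_type s) R := dirac (s : borel_type s).
have mus : Aff_equiv mu delta.
  suff /choquet_le_Aff_equiv h : choquet_le delta mu by move=> f Af; rewrite h.
  apply/choquet_leP => f [cf vf].
  rewrite (Rintegral_dirac (@within_continuous_val _ _ _ s _ cf)).
  by have := dom _ _ (decomposition1 s) cf vf; rewrite decomp_avg1.
(* [mu] is the greatest of the measures with barycentre [s] *)
have below (nu : probability (borel_type s) R) :
    Aff_equiv nu delta -> choquet_le nu mu.
  move=> nus; apply/choquet_leP => f [cf vf]; apply/ler_addgt0Pr => e e0.
  have [D hD le] :=
    decomposition_approx (@within_continuous_val _ _ _ s _ cf) e0 nus.
  by apply: le_trans le _; rewrite lerD2r; exact: dom.
exists mu; split; first split.
(* a measure above [mu] has barycentre [s], so it is also below [mu] *)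
- split=> // nu rnu munu; apply: regular_eq => // f cf.
  have nus : Aff_equiv nu delta.
    by move=> g Ag; rewrite -(choquet_le_Aff_equiv munu Ag) mus.
  apply/eqP; rewrite eq_le.
  by apply/andP; split; apply/choquet_leP: f cf => //; exact: below.
- exact: mus.
- move=> a; have cha := @hat_continuous _ _ _ s a.
  transitivity (\int[delta]_x (hat a x)%:E)%E; last first.
    by rewrite -(mus _ (hat_Aff R a)).
  by rewrite (integral_Rintegral delta cha) (Rintegral_dirac cha).
- by move=> nu [_ numax] nus _; apply: numax => //; exact: below.
Qed.
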